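(* Let $h$ and $m$ be positive definite forms in a Hilbert space $\mathcal{H}$ with common form domain $\mathcal{Q}$, let $\mathbf{H}$ and $\mathbf{M}$ be the selfadjoint operators they define, and suppose that for some $\eta\ge 0$ $$|h(\phi,\psi)-m(\phi,\psi)|\le\eta\sqrt{h[\phi]\,m[\psi]}\qquad\text{for all }\phi,\psi\in\mathcal{Q}.$$ Let $S=\mathbf{H}^{1/2}\mathbf{M}^{-1/2}-\overline{\mathbf{H}^{-1/2}\mathbf{M}^{1/2}}$, let $Q$ and $P$ be orthogonal projections which commute with $\mathbf{H}$ and $\mathbf{M}$, respectively, and put $Q_\perp=I-Q$, $P_\perp=I-P$, $$\mathbf{A}=Q_\perp\mathbf{H}Q_\perp,\quad H=Q\mathbf{H}Q,\quad M=P\mathbf{M}P,\quad \mathbf{W}=P_\perp\mathbf{M}P_\perp .$$ If $|||Q_\perp SP|||_{HS}<\infty$, $|||P_\perp S^*Q|||_{HS}<\infty$, and $\mathsf{gap}(\sigma(\mathbf{A}),\sigma(M))$ and $\mathsf{gap}(\sigma(\mathbf{W}),\sigma(H))$ are both positive, then $Q_\perp P$, $P_\perp Q$ and $P-Q$ are Hilbert--Schmidt operators and $$|||Q_\perp P|||_{HS}^2\le\frac{|||Q_\perp SP|||_{HS}^2}{\mathsf{gap}(\sigma(\mathbf{A}),\sigma(M))^2},$$ $$|||P_\perp Q|||_{HS}^2\le\frac{|||QSP_\perp|||_{HS}^2}{\mathsf{gap}(\sigma(\mathbf{W}),\sigma(H))^2},$$ $$|||P-Q|||_{HS}^2\le\frac{|||Q_\perp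 SP|||_{HS}^2}{\mathsf{gap}(\sigma(\mathbf{A}),\sigma(M))^2}+\frac{|||QSP_\perp|||_{HS}^2}{\mathsf{gap}(\sigma(\mathbf{W}),\sigma(H))^2}.$$
   Context: A positive definite form is a closed, densely defined symmetric sesquilinear form bounded below by a positive constant times $\|\cdot\|^2$; the operator $\mathbf{H}$ defined by $h$ is the selfadjoint operator with $\mathcal{D}(\mathbf{H}^{1/2})=\mathcal{Q}$ and $h(u,v)=(\mathbf{H}^{1/2}u,\mathbf{H}^{1/2}v)$, and similarly for $m$, $\mathbf{M}$. Notation: $h[\phi]=h(\phi,\phi)$, $m[\psi]=m(\psi,\psi)$. The operator $S$ is bounded on $\mathcal{H}$; the bar denotes the closure. A projection $Q$ commutes with $\mathbf{H}$ if $u\in\mathcal{D}(\mathbf{H})$ implies $Qu\in\mathcal{D}(\mathbf{H})$ and $\mathbf{H}Qu=Q\mathbf{H}u$. The operators $\mathbf{A},H,M,\mathbf{W}$ are identified with their restrictions to the orthogonal complements of their kernels, i.e. to the ranges of $Q_\perp,Q,P,P_\perp$, respectively, and $\sigma(\cdot)$ denotes the spectrum of these (positive definite) restrictions. For sets $\Sigma_1,\Sigma_2\subset(0,\infty)$, $$\mathsf{gap}(\Sigma_1,\Sigma_2)=\inf_{\mu\in\Sigma_1,\ \lambda\in\Sigma_2}\frac{|\mu-\lambda|}{\sqrt{\mu\lambda}} .$$ $|||K|||_{HS}=(\mathrm{Tr}\,K^*K)^{1/2}$ is the Hilbert--Schmidt norm. *)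

(* Defs.v *)
From HB Require Import structures.
From mathcomp Require Import all_boot all_order all_algebra.
From mathcomp Require Import complex.
From mathcomp Require Import all_classical all_reals all_analysis.
Import Order.TTheory GRing.Theory Num.Theory.
Import numFieldNormedType.Exports.

Set Implicit Arguments.
Unset Strict Implicit.
Unset Printing Implicit Defensive.

Local Open Scope classical_set_scope.
Local Open Scope ring_scope.
Local Open Scope complex_scope.

(* A complex Hilbert space is a complete normed module V over R[i] together
   with a dot product inducing its norm (linear in the first argument, as in
   sesquilinear.v). *)
Definition induces_norm (R : realType) (V : completeNormedModType R[i])
    (dot : {dot V for Num.conj}) : Prop :=
  forall x : V, `|x| ^+ 2 = dot x x.

(* Possibly unbounded, partially defined operators are represented by their
   graphs. *)
Definition operator (R : realType) (V : completeNormedModType R[i]) : Type :=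
  set (V * V).

Declare Scope operator_scope.
Delimit Scope operator_scope with OP.
Bind Scope operator_scope with operator.

Section Operators.
Context {R : realType} {V : completeNormedModType R[i]}.
Implicit Types (A B : operator V) (X : set V).

Definition graph (f : V -> V) : operator V := [set p | p.2 = f p.1].

Definition op_dom A : set V := [set u | exists v, A (u, v)].

Definition op_ran A : set V := [set v | exists u, A (u, v)].

(* The value is only meaningful for u in the domain of A. *)
Definition op_apply A (u : V) : V := xget 0 [set v | A (u, v)].

Definition op_comp A B : operator V :=
  [set p | exists w, B (p.1, w) /\ A (w, p.2)].

Definition op_sub A B : operator V :=
  [set p | exists a b, [/\ A (p.1, a), B (p.1, b) & p.2 = a - b]].

Definition op_inv A : operator V := [set p | A (p.2, p.1)].

Definition op_closure A : operator V := closure A.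

Definition op_restrict X A : operator V := [set p | A p /\ X p.1].

Definition bounded_operator A : Prop :=
  exists f : {linear V -> V}, continuous f /\ A = graph f.

(* The resolvent set of the restriction of A to the closed subspace X, as an
   operator in the Hilbert space X; A is meant to map X into X. *)
Definition resolvent_set X A : set R[i] :=
  [set z | let Az := op_restrict X (op_sub A (graph (fun u => z *: u))) in
    (forall f, X f -> exists! u, Az (u, f)) /\
    exists c : R[i], forall u f, Az (u, f) -> `|u| <= c * `|f| ].

Definition spectrum X A : set R[i] := ~` resolvent_set X A.

(* The spectrum of a selfadjoint operator, as a set of real numbers. *)
Definition real_spectrum X A : set R := [set x | spectrum X A x%:C].

Definition commutes (P : V -> V) A : Prop :=
  forall u v, A (u, v) -> A (P u, P v).

End Operators.

Notation "1" := (graph idfun) : operator_scope.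
Notation "A * B" := (op_comp A B) : operator_scope.
Notation "A - B" := (op_sub A B) : operator_scope.
Notation "A ^-1" := (op_inv A) : operator_scope.

Section HilbertSpace.
Context {R : realType} {V : completeNormedModType R[i]}.
Variable dot : {dot V for Num.conj}.
Implicit Types (A B K T : operator V) (Q : set V) (h : V -> V -> R[i]).

Definition adjoint A : operator V :=
  [set p | forall q, A q -> dot q.2 p.1 = dot q.1 p.2].

Definition selfadjoint A : Prop := dense (op_dom A) /\ adjoint A = A.

Definition nonnegative A : Prop := forall u v, A (u, v) -> 0 <= dot v u.

Definition is_sqrt B A : Prop :=
  [/\ selfadjoint B, nonnegative B & op_comp B B = A].

Definition orthogonal_projection (P : {linear V -> V}) : Prop :=
  (forall u, P (P u) = P u) /\ (forall u v, dot (P u) v = dot u (P v)).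

(* h[u]; the real part loses nothing, as h u u is real for symmetric h. *)
Definition quad h (u : V) : R := complex.Re (h u u).

(* A form with domain Q is a function on V whose values matter on Q only. *)
Definition subspace Q : Prop :=
  Q 0 /\ forall (a : R[i]) u v, Q u -> Q v -> Q (a *: u + v).

Definition sesquilinear_on Q h : Prop :=
  (forall a u v w, Q u -> Q v -> Q w ->
     h (a *: u + v) w = a * h u w + h v w) /\
  (forall a u v w, Q u -> Q v -> Q w ->
     h w (a *: u + v) = Num.conj a * h w u + h w v).

Definition symmetric_on Q h : Prop :=
  forall u v, Q u -> Q v -> h u v = Num.conj (h v u).

Definition closed_form Q h : Prop :=
  forall (x : nat -> V) (l : V), (forall n, Q (x n)) ->
    x n @[n --> \oo] --> l ->
    quad h (x k.1 - x k.2) @[k --> filter_prod \oo \oo] --> (0 : R) ->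
    Q l /\ quad h (x n - l) @[n --> \oo] --> (0 : R).

Definition positive_definite_form Q h : Prop :=
  [/\ subspace Q /\ dense Q,
      sesquilinear_on Q h,
      symmetric_on Q h,
      closed_form Q h &
      exists2 c : R, 0 < c & forall u, Q u -> c * quad dot u <= quad h u].

(* A is the selfadjoint operator defined by the form h with domain Q, and B is
   its square root. *)
Definition form_operator Q h A B : Prop :=
  [/\ selfadjoint A, is_sqrt B A, op_dom B = Q &
      forall u v, Q u -> Q v -> h u v = dot (op_apply B u) (op_apply B v)].

Definition orthonormal_basis (E : set V) : Prop :=
  (forall e f, E e -> E f -> dot e f = (e == f)%:R) /\
  (forall x, (forall e, E e -> dot x e = 0) -> x = 0).

(* Some orthonormal basis; one exists, by orthonormal_basis_exists below. *)
Definition onb : set V := xget set0 orthonormal_basis.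

(* Trace of a bounded nonnegative operator, possibly infinite; for such
   operators it does not depend on the choice of the orthonormal basis. *)
Definition trace T : \bar R :=
  (\esum_(e in onb) (complex.Re (dot (op_apply T e) e))%:E)%E.

Definition hs_norm K : \bar R :=
  (trace (op_comp (adjoint K) K) `^ 2^-1)%E.

Definition hilbert_schmidt K : Prop :=
  bounded_operator K /\ (hs_norm K < +oo)%E.

Lemma orthonormal_basis_exists : exists E, orthonormal_basis E.
Proof.
pose ons (E : set V) := forall e f, E e -> E f -> dot e f = (e == f)%:R.
have [F Fons tF|E [Eons maxE]] := @Zorn_bigcup V ons.
  move=> e f [A FA Ae] [B FB Bf].
  have [AB|BA] := tF _ _ FA FB.
    exact: (Fons _ FB _ _ (AB _ Ae) Bf).
  exact: (Fons _ FA _ _ Ae (BA _ Bf)).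
exists E; split=> // x xE; apply: contrapT => /eqP x0.
have dxx : 0 < dot x x by rewrite dnorm_gt0.
pose y := (sqrtC (dot x x))^-1 *: x.
have s0 : 0 < sqrtC (dot x x) by rewrite sqrtC_gt0.
have yE e : E e -> dot y e = 0 by move=> Ee; rewrite linearZl_LR /= (xE _ Ee) mulr0.
have Ey e : E e -> dot e y = 0.
  move=> Ee; have -> : dot e y = _ := hermC dot e y.
  by rewrite [X in _ * _ X]yE// rmorph0 mulr0.
have yy : dot y y = 1.
  rewrite linearZl_LR linearZr_LR /= conj_Creal ?realV ?gtr0_real//.
  rewrite mulrA -expr2 exprVn sqrtCK mulVf// gt_eqF//.
have nEy : ~ E y by move=> /yE; rewrite yy => /eqP; rewrite oner_eq0.
apply: (maxE (E `|` [set y])).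
  split=> [|sub]; first by move=> z Ez; left.
  by apply: nEy; apply: sub; right.
move=> e f [Ee|->] [Ef|->]; first exact: Eons.
- by rewrite Ey//; case: eqP => // ey; case: nEy; rewrite -ey.
- by rewrite yE//; case: eqP => // ye; case: nEy; rewrite ye.
- by rewrite yy eqxx.
Qed.

End HilbertSpace.

(* Infimum over the empty set is +oo, and +oo^-1 = 0 in \bar R. *)
Definition gap (R : realType) (S1 S2 : set R) : \bar R :=
  ereal_inf [set (`|mu - la| / Num.sqrt (mu * la))%:E | mu in S1 & la in S2].

(* Main.v *)
Require Import Defs.
From HB Require Import structures.
From mathcomp Require Import all_boot all_order all_algebra.
From mathcomp Require Import cyclic separable cyclotomic finmap complex ring lra.
From mathcomp Require Import all_classical all_reals all_analysis.
Import Order.TTheory GRing.Theory Num.Theory.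
Import numFieldNormedType.Exports.

Set Implicit Arguments.
Unset Strict Implicit.
Unset Printing Implicit Defensive.

Local Open Scope classical_set_scope.
Local Open Scope ring_scope.
Local Open Scope complex_scope.

(** Let a = H^(-1/2) and b = M^(-1/2). These are bounded, because the forms are
    bounded below by positive constants, and the comparison of the two forms
    makes S bounded with a S b = b^2 - a^2 ([difference_operator]). The
    projections Q and P commute with a and b as well ([commute_sqrt]), so
    X = Q_perp P is a bounded solution of the Sylvester equation
      X b^2 - a^2 X = a T b,   T = Q_perp S P.
    If a^2 and b^2 were diagonal, with eigenvalues 1/l for l in the spectrum of
    A and 1/m for m in that of M, the equation would read
      X_lm = sqrt (l m) / (l - m) T_lm,
    and the first inequality would follow by summing squares. The other two are
    consequences: the second is the first with the roles of h and m exchanged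
    and S replaced by - S*, since an operator and its adjoint have the same
    Hilbert-Schmidt norm ([hs2_adj]); and P - Q = Q_perp P - Q P_perp is a
    decomposition with orthogonal ranges ([hs2_projections]).

    Without diagonalization, only a^2 is decomposed, and only approximately:
    from the powers of its Cayley transform, a discrete Fourier transform makes
    operators phi_i with sum phi_i* phi_i = 1 which are localized at real
    numbers n_i, in the sense that (a^2 - n_i) phi_i is small
    ([cayley_partition]). On the piece phi_i X the equation is close to
    X (b^2 - n_i) = a T b. If n_i = 1/l with l in the spectrum of A, the gap
    condition says that |(b^2 - n_i) w| >= gap sqrt(n_i) |b w| on the range of P
    ([relative_gap]), whence the solution a phi_i T b (b^2 - n_i)^-1 of this
    equation has a Hilbert-Schmidt norm of at most |phi_i T| / gap, up to a
    small error; if n_i is far from the spectrum, phi_i X is itself small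
    ([gap_dichotomy]). The sum of the pieces converges strongly to X while its
    Hilbert-Schmidt norm is at most (1 + o(1)) |T| / gap ([sylvester_approx]),
    and the Hilbert-Schmidt norm is lower semicontinuous ([sylvester_hs2]).

    All the spectral theory this takes is contained in [spectral_gap]: for a
    selfadjoint operator with bounded inverse whose spectrum misses the interval
    of center l and radius d, |(A - l) u| >= d |u|. *)

(** * Inner product and norm with values in the real numbers *)

Lemma small_le0 (R : realType) (r C : R) : (forall e : R, 0 < e -> r <= C * e) -> r <= 0.
Proof.
move=> h; apply/ler_addgt0Pl => e e0; rewrite addr0.
have C0 : 0 < `|C| + 1 by rewrite ltr_wpDl.
apply: (le_trans (h (e / (`|C| + 1)) (divr_gt0 e0 C0))).
rewrite mulrCA ger_pMr//; rewrite ler_pdivrMr// mul1r.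
by have := ler_norm C; lra.
Qed.

Section InnerProduct.
Context {R : realType} {V : completeNormedModType R[i]}.
Variable dot : {dot V for Num.conj}.
Implicit Types (x y z : V) (r s : R) (c : R[i]).

(** V is also a real Hilbert space, and real bilinear expansions can be left to
    decision procedures for ordered fields. *)
Definition re_dot x y : R := complex.Re (dot x y).
Local Notation rdot := re_dot.
Definition dot_norm x : R := Num.sqrt (rdot x x).
Local Notation nr := dot_norm.

Lemma dotDl x y z : dot (x + y) z = dot x z + dot y z.
Proof. exact: linearDl. Qed.
Lemma dotDr x y z : dot z (x + y) = dot z x + dot z y.
Proof. exact: linearDr. Qed.
Lemma dotZl c x y : dot (c *: x) y = c * dot x y.
Proof. by rewrite linearZl_LR. Qed.
Lemma dotZr c x y : dot x (c *: y) = Num.conj c * dot x y.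
Proof. by rewrite linearZr_LR. Qed.
Lemma dot0l x : dot 0 x = 0.
Proof. exact: linear0l. Qed.
Lemma dot0r x : dot x 0 = 0.
Proof. exact: linear0r. Qed.
Lemma dotNl x y : dot (- x) y = - dot x y.
Proof. exact: linearNl. Qed.
Lemma dotNr x y : dot x (- y) = - dot x y.
Proof. exact: linearNr. Qed.
Lemma dotBl x y z : dot (x - y) z = dot x z - dot y z.
Proof. by rewrite dotDl dotNl. Qed.
Lemma dotBr x y z : dot z (x - y) = dot z x - dot z y.
Proof. by rewrite dotDr dotNr. Qed.
Lemma dotC x y : dot x y = Num.conj (dot y x).
Proof. by rewrite hermC/= expr0 mul1r. Qed.
Lemma dot_suml (I : Type) (s : seq I) (P : pred I) (F : I -> V) y :
  dot (\sum_(i <- s | P i) F i) y = \sum_(i <- s | P i) dot (F i) y.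
Proof.
by elim/big_rec2 : _ => [|i a b _ <-]; rewrite ?dot0l // dotDl.
Qed.
Lemma dot_sumr (I : Type) (s : seq I) (P : pred I) (F : I -> V) y :
  dot y (\sum_(i <- s | P i) F i) = \sum_(i <- s | P i) dot y (F i).
Proof.
by elim/big_rec2 : _ => [|i a b _ <-]; rewrite ?dot0r // dotDr.
Qed.

Lemma ReD (a b : R[i]) : complex.Re (a + b) = complex.Re a + complex.Re b.
Proof. by case: a; case: b. Qed.
Lemma ReN (a : R[i]) : complex.Re (- a) = - complex.Re a.
Proof. by case: a. Qed.
Lemma Re_conj (a : R[i]) : complex.Re (Num.conj a) = complex.Re a.
Proof. by case: a. Qed.
Lemma ReZ r (a : R[i]) : complex.Re (r%:C * a) = r * complex.Re a.
Proof. by case: a => u v /=; rewrite mul0r subr0. Qed.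
Lemma conjR r : Num.conj r%:C = r%:C :> R[i].
Proof. by rewrite /Num.conj/= oppr0. Qed.
Lemma Re_sum (I : Type) (s : seq I) (P : pred I) (F : I -> R[i]) :
  complex.Re (\sum_(i <- s | P i) F i) = \sum_(i <- s | P i) complex.Re (F i).
Proof. by elim/big_rec2 : _ => [|i a b _ <-] //; rewrite ReD. Qed.

Lemma rdotC x y : rdot x y = rdot y x.
Proof. by rewrite /re_dot dotC Re_conj. Qed.
Lemma rdotDl x y z : rdot (x + y) z = rdot x z + rdot y z.
Proof. by rewrite /re_dot dotDl ReD. Qed.
Lemma rdotDr x y z : rdot z (x + y) = rdot z x + rdot z y.
Proof. by rewrite /re_dot dotDr ReD. Qed.
Lemma rdotNl x y : rdot (- x) y = - rdot x y.
Proof. by rewrite /re_dot dotNl ReN. Qed.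
Lemma rdotNr x y : rdot x (- y) = - rdot x y.
Proof. by rewrite /re_dot dotNr ReN. Qed.
Lemma rdotZl r x y : rdot (r%:C *: x) y = r * rdot x y.
Proof. by rewrite /re_dot dotZl ReZ. Qed.
Lemma rdotZr r x y : rdot x (r%:C *: y) = r * rdot x y.
Proof. by rewrite /re_dot dotZr conjR ReZ. Qed.
Lemma rdot0l x : rdot 0 x = 0.
Proof. by rewrite /re_dot dot0l. Qed.
Definition rdotE := (rdotDl, rdotDr, rdotNl, rdotNr, rdotZl, rdotZr).
Lemma rdot_suml (I : Type) (s : seq I) (P : pred I) (F : I -> V) y :
  rdot (\sum_(i <- s | P i) F i) y = \sum_(i <- s | P i) rdot (F i) y.
Proof. by rewrite /re_dot dot_suml Re_sum. Qed.

Lemma dotxx x : dot x x = (rdot x x)%:C.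
Proof.
have := dnorm_ge0 dot x; rewrite /re_dot; case: (dot x x) => a b.
by rewrite lecE/= => /andP[/eqP ->].
Qed.

Lemma rdot_ge0 x : 0 <= rdot x x.
Proof. by rewrite -lecR -dotxx dnorm_ge0. Qed.
Lemma nr_ge0 x : 0 <= nr x.
Proof. exact: sqrtr_ge0. Qed.
Hint Resolve nr_ge0 rdot_ge0 : core.
Lemma nr2 x : nr x ^+ 2 = rdot x x.
Proof. by rewrite sqr_sqrtr. Qed.
Lemma rdotxx_eq0 x : rdot x x = 0 -> x = 0.
Proof. by move=> h; apply/eqP; rewrite -(dnorm_eq0 dot) dotxx h. Qed.
Lemma nr_eq0 x : nr x = 0 -> x = 0.
Proof. by move=> h; apply: rdotxx_eq0; rewrite -nr2 h expr0n. Qed.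
Lemma nr0 : nr 0 = 0.
Proof. by rewrite /dot_norm rdot0l sqrtr0. Qed.
Lemma nr_gt0 x : x != 0 -> 0 < nr x.
Proof.
by move=> x0; rewrite lt0r nr_ge0 andbT; apply: contra_neq x0; exact: nr_eq0.
Qed.
Lemma nrN x : nr (- x) = nr x.
Proof. by rewrite /dot_norm !rdotE opprK. Qed.
Lemma nrBC x y : nr (x - y) = nr (y - x).
Proof. by rewrite -nrN opprB. Qed.

Lemma ler_nr x y : (nr x <= nr y) = (rdot x x <= rdot y y).
Proof. by rewrite -!nr2 ler_pXn2r// nnegrE. Qed.

(** The Cauchy-Schwarz inequality for a merely nonnegative symmetric form with
    values A, B, C on a pair of vectors; A = 0 is allowed. *)
Lemma discriminant_le (A B C : R) : 0 <= A ->
  (forall t : R, 0 <= A * t ^+ 2 + 2 * B * t + C) -> B ^+ 2 <= A * C.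
Proof.
move=> A0 h; have [A00|A_neq0] := eqVneq A 0.
  have [->|B0] := eqVneq B 0; first by rewrite expr0n A00 mul0r.
  have := h (- (C + 1) / (2 * B)).
  have -> : A * (- (C + 1) / (2 * B)) ^+ 2 + 2 * B * (- (C + 1) / (2 * B)) + C = -1.
    by rewrite A00; field.
  lra.
have Agt0 : 0 < A by rewrite lt0r A_neq0.
have := h (- B / A).
have -> : A * (- B / A) ^+ 2 + 2 * B * (- B / A) + C = (A * C - B ^+ 2) / A.
  by field.
by rewrite pmulr_lge0 ?invr_gt0// subr_ge0.
Qed.

Lemma rdot_CS2 x y : rdot x y ^+ 2 <= rdot x x * rdot y y.
Proof.
apply: discriminant_le => // t.
have := rdot_ge0 (t%:C *: x + y); rewrite !rdotE (rdotC y x).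
by congr (_ <= _); ring.
Qed.

Lemma rdot_CS x y : rdot x y <= nr x * nr y.
Proof.
have [h|h] := leP (rdot x y) 0.
  exact: (le_trans h (mulr_ge0 _ _)).
rewrite -(ler_pXn2r (_ : 0 < 2)%N) ?nnegrE ?mulr_ge0 ?(ltW h)//.
by rewrite exprMn !nr2 rdot_CS2.
Qed.

Lemma nrD x y : nr (x + y) <= nr x + nr y.
Proof.
rewrite -(ler_pXn2r (_ : 0 < 2)%N) ?nnegrE ?addr_ge0// sqrrD !nr2 !rdotE.
have := rdot_CS x y; rewrite (rdotC y x) mulr2n; lra.
Qed.

Lemma nrB_le x y : nr (x - y) <= nr x + nr y.
Proof. by rewrite -(nrN y) nrD. Qed.

Lemma nrB_ge x y : nr x - nr y <= nr (x - y).
Proof. by have := nrD (x - y) y; rewrite subrK; lra. Qed.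

Lemma parallelogram x y :
  nr (x + y) ^+ 2 + nr (x - y) ^+ 2 = 2 * nr x ^+ 2 + 2 * nr y ^+ 2.
Proof. by rewrite !nr2 !rdotE (rdotC y x); ring. Qed.

Definition mdl c : R := complex.Re `|c|.
Lemma mdlE c : (mdl c)%:C = `|c|.
Proof. by rewrite /mdl RRe_real// normr_real. Qed.
Lemma mdl_ge0 c : 0 <= mdl c.
Proof. by rewrite -ler0c mdlE. Qed.
Lemma mdlR r : mdl r%:C = `|r|.
Proof. by rewrite /mdl normc_def/= expr0n addr0 sqrtr_sqr. Qed.
Lemma mdlM c d : mdl (c * d) = mdl c * mdl d.
Proof. by apply: complexI; rewrite rmorphM !mdlE normrM. Qed.
Lemma mdl2 c : ((mdl c) ^+ 2)%:C = c * Num.conj c.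
Proof. by rewrite rmorphXn/= mdlE -normCK. Qed.
Lemma Re_le_mdl c : complex.Re c <= mdl c.
Proof.
have := normc_ge_Re c; rewrite -mdlE lecR; apply: le_trans; exact: ler_norm.
Qed.

Lemma nrZ c x : nr (c *: x) = mdl c * nr x.
Proof.
apply/eqP; rewrite -(eqrXn2 (_ : 0 < 2)%N) ?mulr_ge0 ?mdl_ge0//; apply/eqP.
apply: complexI; rewrite !exprMn nr2 -dotxx dotZl dotZr mulrA -mdl2 dotxx -nr2 -rmorphM.
by [].
Qed.
Lemma nrZR r x : nr (r%:C *: x) = `|r| * nr x.
Proof. by rewrite nrZ mdlR. Qed.

(** Rotating x by the conjugate of the phase of dot x y reduces to the real
    inequality. *)
Lemma mdl_dot x y : mdl (dot x y) <= nr x * nr y.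
Proof.
pose c := dot x y; have [c0|c0] := eqVneq c 0.
  by rewrite -/c c0 /mdl normr0 mulr_ge0.
have m0 : 0 < mdl c.
  by rewrite -ltcR mdlE normr_gt0.
have := rdot_CS (Num.conj c *: x) y; rewrite /re_dot dotZl -/c mulrC -mdl2/=.
rewrite nrZ; have -> : mdl (Num.conj c) = mdl c by rewrite /mdl norm_conjC.
by rewrite expr2 -mulrA ler_pM2l.
Qed.

Lemma dot_rdot x y : dot x y = (rdot x y)%:C + 'i * (rdot x ('i *: y))%:C.
Proof.
rewrite /re_dot dotZr; case: (dot x y) => a b; rewrite /Num.conj /=.
by apply/eqP; rewrite eq_complex /=; apply/andP; split; apply/eqP; ring.
Qed.

Lemma rdot_dot x y x' y' :
  (forall c, rdot x (c *: y) = rdot x' (c *: y')) -> dot x y = dot x' y'.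
Proof.
by move=> h; rewrite !dot_rdot h; have := h 1; rewrite !scale1r => ->.
Qed.

Lemma rdot_inj x y : (forall z, rdot x z = rdot y z) -> x = y.
Proof.
move=> h; apply/eqP; rewrite -subr_eq0; apply/eqP/rdotxx_eq0.
by rewrite rdotDl rdotNl h subrr.
Qed.

Lemma dot_inj x y : (forall z, dot x z = dot y z) -> x = y.
Proof. by move=> h; apply: rdot_inj => z; rewrite /re_dot h. Qed.

Lemma small_eq0 x (C : R) : (forall e, 0 < e -> nr x <= C * e) -> x = 0.
Proof.
by move=> h; apply: nr_eq0; apply/eqP; rewrite eq_le nr_ge0 (small_le0 h).
Qed.

End InnerProduct.
#[export] Hint Extern 0 (is_true (@Order.le _ _ _ (dot_norm _ _))) => apply: nr_ge0 : core.
#[export] Hint Extern 0 (is_true (@Order.le _ _ _ (re_dot _ ?x ?x))) => apply: rdot_ge0 : core.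
#[export] Hint Extern 0 (is_true (@Order.le _ _ _ (mdl _))) => apply: mdl_ge0 : core.

(** * Bounded linear operators and their adjoints *)

Section BoundedLinear.
Context {R : realType} {V : completeNormedModType R[i]}.
Variable dot : {dot V for Num.conj}.
Local Notation nr := (dot_norm dot).
Local Notation rdot := (re_dot dot).
Implicit Types (x y z : V) (f g : V -> V).

Definition bounded_by (C : R) f := forall x, nr (f x) <= C * nr x.
Definition blin f := linear f /\ exists C, bounded_by C f.
Definition adj f g := forall x y, dot (f x) y = dot x (g y).

Lemma linD f : linear f -> forall x y, f (x + y) = f x + f y.
Proof. by move=> h x y; have := h 1 x y; rewrite !scale1r. Qed.
Lemma lin0 f : linear f -> f 0 = 0.
Proof.
by move=> h; apply/(addrI (f 0)); rewrite -linD// !addr0.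
Qed.
Lemma linZ f : linear f -> forall c x, f (c *: x) = c *: f x.
Proof. by move=> h c x; have := h c x 0; rewrite addr0 => ->; rewrite lin0// addr0. Qed.
Lemma linN f : linear f -> forall x, f (- x) = - f x.
Proof. by move=> h x; rewrite -scaleN1r linZ// scaleN1r. Qed.
Lemma linB f : linear f -> forall x y, f (x - y) = f x - f y.
Proof. by move=> h x y; rewrite linD// linN. Qed.
Lemma lin_sum f (I : Type) (s : seq I) (P : pred I) (F : I -> V) :
  linear f -> f (\sum_(i <- s | P i) F i) = \sum_(i <- s | P i) f (F i).
Proof.
by move=> h; elim/big_rec2 : _ => [|i a b _ <-]; rewrite ?lin0// linD.
Qed.

Lemma blin_lin f : blin f -> linear f. Proof. by case. Qed.

Lemma blin_pos f : blin f -> exists2 C : R, 0 < C & bounded_by C f.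
Proof.
move=> [_ [C h]]; exists (`|C| + 1) => [|x]; first by rewrite ltr_wpDl.
by apply: (le_trans (h x)); apply: ler_wpM2r => //; have := ler_norm C; lra.
Qed.

Lemma blin_id : blin idfun.
Proof. by split=> //; exists 1 => x; rewrite mul1r. Qed.

Lemma blin_comp f g : blin f -> blin g -> blin (f \o g).
Proof.
move=> hf hg; split=> [c x y|].
  by rewrite /= (blin_lin hg) (blin_lin hf).
have [C C0 Cf] := blin_pos hf; have [D D0 Dg] := blin_pos hg.
exists (C * D) => x; apply: (le_trans (Cf _)).
by rewrite -mulrA ler_pM2l.
Qed.

Lemma blin_add f g : blin f -> blin g -> blin (fun x => f x + g x).
Proof.
move=> hf hg; split=> [c x y|].
  by rewrite /= (blin_lin hg) (blin_lin hf) scalerDr addrACA.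
have [C C0 Cf] := blin_pos hf; have [D D0 Dg] := blin_pos hg.
exists (C + D) => x; apply: (le_trans (nrD _ _ _)).
by rewrite mulrDl lerD.
Qed.

Lemma blin_scale c f : blin f -> blin (fun x => c *: f x).
Proof.
move=> hf; split=> [d x y|].
  by rewrite /= (blin_lin hf) scalerDr !scalerA mulrC.
have [C C0 Cf] := blin_pos hf.
exists (mdl c * C) => x; rewrite nrZ -mulrA.
by apply: ler_wpM2l => //; exact: Cf.
Qed.

Lemma blin_opp f : blin f -> blin (fun x => - f x).
Proof.
by move=> /(blin_scale (-1)); under eq_fun do rewrite scaleN1r.
Qed.

Lemma blin_sub f g : blin f -> blin g -> blin (fun x => f x - g x).
Proof. by move=> hf /blin_opp; exact: blin_add. Qed.

Lemma blin_zero : blin (fun=> 0).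
Proof.
split=> [c x y|]; first by rewrite scaler0 addr0.
by exists 0 => x; rewrite nr0 mul0r.
Qed.

Lemma blin_sum (I : Type) (s : seq I) (P : pred I) (F : I -> V -> V) :
  (forall i, P i -> blin (F i)) -> blin (fun x => \sum_(i <- s | P i) F i x).
Proof.
move=> h; elim: s => [|i s ih].
  by under eq_fun do rewrite big_nil; exact: blin_zero.
under eq_fun do rewrite big_cons.
case Pi : (P i) => //; apply: blin_add => //; exact: h.
Qed.

Lemma blin_iter k f : blin f -> blin (iter k f).
Proof.
by move=> hf; elim: k => [|k ih]; [exact: blin_id|exact: blin_comp hf ih].
Qed.

Lemma adj_rdot f g : adj f g -> forall x y, rdot (f x) y = rdot x (g y).
Proof. by move=> h x y; rewrite /re_dot h. Qed.

Lemma adjC f g : adj f g -> adj g f.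
Proof. by move=> h x y; rewrite dotC -h -dotC. Qed.

Lemma adj_comp f f' g g' : adj f f' -> adj g g' -> adj (f \o g) (g' \o f').
Proof. by move=> h k x y /=; rewrite h k. Qed.

(** The adjoint obeys every bound of the operator, since
    |f* y|^2 = <f f* y, y>. *)
Lemma adj_bounded f g C : 0 <= C -> adj f g -> bounded_by C f -> bounded_by C g.
Proof.
move=> C0 fg fC y; have [->|y0] := eqVneq (g y) 0; first by rewrite nr0 mulr_ge0.
have g0 : 0 < nr (g y) by exact: nr_gt0.
rewrite -(ler_pM2l g0) -expr2 nr2 -(adj_rdot fg).
apply: (le_trans (rdot_CS _ _ _)); rewrite mulrA ler_wpM2r//.
by rewrite (mulrC (nr (g y))).
Qed.

Lemma adj_linear f g : adj f g -> linear f.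
Proof.
by move=> fg c x y; apply: (@dot_inj _ _ dot) => z; rewrite dotDl dotZl !fg dotDl dotZl.
Qed.

Lemma adj_blin f g : adj f g -> blin f -> blin g.
Proof.
move=> fg /blin_pos[C C0 h]; split; first exact: adj_linear (adjC fg).
by exists C; apply: adj_bounded fg h; exact: ltW.
Qed.

End BoundedLinear.

(** * Orthogonal projections, adjoints and invertibility *)

Section Projection.
Context {R : realType} {V : completeNormedModType R[i]}.
Variable dot : {dot V for Num.conj}.
Hypothesis dotV : induces_norm dot.
Local Notation nr := (dot_norm dot).
Local Notation rdot := (re_dot dot).
Implicit Types (x y z : V) (f g : V -> V) (W : set V).

Lemma normE x : `|x| = (nr x)%:C.
Proof.
apply/eqP; rewrite -(eqrXn2 (_ : 0 < 2)%N) ?ler0c// ?nr_ge0// dotV dotxx -nr2.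
by rewrite rmorphXn.
Qed.

Definition near_set W x := forall e : R, 0 < e -> exists2 w, W w & nr (x - w) <= e.

Lemma nr_complete (u : nat -> V) :
  (forall e : R, 0 < e -> exists N, forall m n, (N <= m)%N -> (N <= n)%N ->
     nr (u m - u n) <= e) ->
  exists l, forall e : R, 0 < e -> exists N, forall n, (N <= n)%N ->
     nr (u n - l) <= e.
Proof.
move=> cu; have /cvg_ex[/= l ul] : cvg (u @ \oo).
  apply/cauchy_cvgP/cauchy_ballP => e e0.
  have [er eE] : exists r : R, e = r%:C by apply/complex_realP/gtr0_real.
  move: e0; rewrite eE ltcR => r0.
  have [N hN] := cu (er / 2) ltac:(lra).
  exists (u @` [set n | (N <= n)%N], u @` [set n | (N <= n)%N]) => /=.
    by split; exists N => // n /= Nn; exists n.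
  move=> [_ _] [/= [m /= Nm <-] [n /= Nn <-]]; rewrite -ball_normE /= normE ltcR.
  by apply: (le_lt_trans (hN _ _ Nm Nn)); lra.
exists l => e e0; move/cvgrPdist_le : ul => /(_ e%:C).
rewrite ltcR => /(_ e0)[N _ hN]; exists N => n Nn.
by have := hN n Nn; rewrite /= normE lecR nrBC.
Qed.

Lemma near_setP W x : near_set W x ->
  exists2 u : nat -> V, (forall n, W (u n)) & forall n, nr (x - u n) <= n.+1%:R^-1.
Proof.
move=> h; have [n|u hu] := @choice nat V (fun n w => W w /\ nr (x - w) <= n.+1%:R^-1).
  have [w Ww xw] := h n.+1%:R^-1 ltac:(by rewrite invr_gt0).
  by exists w.
by exists u => n; case: (hu n).
Qed.

Lemma inv_nat_lt (e : R) : 0 < e -> exists N, forall n, (N <= n)%N -> (n.+1%:R)^-1 <= e.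
Proof.
move=> e0; exists (Num.bound e^-1) => n Nn.
rewrite -[leRHS]invrK lef_pV2 ?posrE ?invr_gt0//.
have := archi_boundP (ltW (_ : 0 < e^-1)); rewrite invr_gt0 => /(_ e0) h.
by rewrite (le_trans (ltW h))// ler_nat (leq_trans Nn).
Qed.

(** Projection theorem: a minimizing sequence is Cauchy by the parallelogram
    law. *)
Lemma projection W x : Defs.subspace W -> (forall y, near_set W y -> W y) ->
  exists2 p, W p & forall w, W w -> dot (x - p) w = 0.
Proof.
move=> [W0 Wlin] Wcl.
have WD u v : W u -> W v -> W (u + v) by move=> Wu Wv; rewrite -[u]scale1r; exact: Wlin.
have WZ c u : W u -> W (c *: u) by move=> Wu; rewrite -[_ *: _]addr0; exact: Wlin.
pose D := [set nr (x - w) | w in W]; pose d := inf D.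
have D0 : D !=set0 by exists (nr (x - 0)), 0.
have Dlb : has_lbound D by exists 0 => _ [w _ <-].
have dle w : W w -> d <= nr (x - w) by move=> Ww; apply: ge_inf => //; exists w.
have d0 : 0 <= d by apply: lb_le_inf => // _ [w _ <-].
have dapp (e : R) : 0 < e -> exists2 w, W w & nr (x - w) <= d + e.
  move=> e0; have [_ [w Ww <-] h] := inf_adherent e0 (conj D0 Dlb).
  by exists w => //; exact: ltW.
have [n|u hu] := @choice nat V (fun n w => W w /\ nr (x - w) <= d + n.+1%:R^-1).
  by have [w Ww hw] := dapp n.+1%:R^-1 ltac:(by rewrite invr_gt0); exists w.
have close (t : R) m n : 0 <= t -> t <= 1 -> nr (x - u m) <= d + t -> nr (x - u n) <= d + t ->
    nr (u m - u n) ^+ 2 <= (8 * d + 4) * t.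
  move=> t0 t1 hm hn.
  have := parallelogram dot (x - u m) (x - u n).
  have -> : x - u m - (x - u n) = u n - u m by rewrite opprB addrC addrA subrK.
  have -> : x - u m + (x - u n) = 2%:C *: (x - 2^-1%:C *: (u m + u n)).
    rewrite scalerBr scalerA -rmorphM/= mulfV ?pnatr_eq0// scale1r.
    by rewrite (_ : 2%:C = 1 + 1) ?rmorphD/= ?rmorph1// scalerDl scale1r opprD addrACA.
  rewrite nrZR (nrBC _ (u n)) exprMn real_normK ?num_real//.
  have hd : d <= nr (x - 2^-1%:C *: (u m + u n)).
    by apply: dle; apply: WZ; apply: WD; case: (hu m); case: (hu n).
  have : d ^+ 2 <= nr (x - 2^-1%:C *: (u m + u n)) ^+ 2 by rewrite ler_sqr ?nnegrE.
  have : nr (x - u m) ^+ 2 <= (d + t) ^+ 2 by rewrite ler_sqr ?nnegrE// addr_ge0.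
  have : nr (x - u n) ^+ 2 <= (d + t) ^+ 2 by rewrite ler_sqr ?nnegrE// addr_ge0.
  have : t ^+ 2 <= t by rewrite expr2 ler_piMr.
  by rewrite sqrrD; nra.
have [|l ul] := nr_complete (u := u).
  move=> e e0; pose t := Num.min 1 (e ^+ 2 / (8 * d + 4)).
  have dd : 0 < 8 * d + 4 by lra.
  have t0 : 0 < t by rewrite lt_min ltr01 divr_gt0// exprn_gt0.
  have t1 : t <= 1 by rewrite ge_min lexx.
  have te : (8 * d + 4) * t <= e ^+ 2.
    by rewrite mulrC -ler_pdivlMr// ge_min lexx orbT.
  have [N hN] := inv_nat_lt t0; exists N => m n Nm Nn.
  rewrite -(ler_pXn2r (_ : 0 < 2)%N) ?nnegrE ?(ltW e0)//; apply: le_trans te.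
  apply: close => //; first exact: ltW.
    by case: (hu m) => _ /le_trans; apply; rewrite lerD2l hN.
  by case: (hu n) => _ /le_trans; apply; rewrite lerD2l hN.
have Wl : W l.
  apply: Wcl => e e0; have [N hN] := ul e e0; exists (u N); first by case: (hu N).
  by rewrite nrBC hN.
have dl : nr (x - l) <= d.
  apply/ler_addgt0Pl => e e0; have e2 : 0 < e / 2 by lra.
  have [N hN] := ul _ e2; have [N' hN'] := inv_nat_lt e2.
  pose n := maxn N N'.
  have -> : x - l = (x - u n) + (u n - l) by rewrite addrA subrK.
  apply: (le_trans (nrD _ _ _)).
  apply: (le_trans (lerD (hu n).2 (hN n (leq_maxl _ _)))).
  move: (hN' n (leq_maxr _ _)); move: (n.+1%:R^-1 : R) => t; lra.
exists l => // w Ww; rewrite -(dot0l dot w); apply: rdot_dot => c.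
rewrite rdot0l; apply/eqP; rewrite -sqrf_eq0 eq_le sqr_ge0 andbT.
have Wc : W (c *: w) by exact: WZ.
have := @discriminant_le _ (rdot (c *: w) (c *: w)) (- rdot (x - l) (c *: w)) 0 (rdot_ge0 _ _).
rewrite mulr0 sqrrN; apply => t; rewrite addr0.
have h : nr (x - l) ^+ 2 <= nr (x - (l + t%:C *: (c *: w))) ^+ 2.
  rewrite ler_sqr ?nnegrE//; apply: (le_trans dl); apply: dle.
  by apply: WD => //; exact: WZ.
move: h; move: (c *: w) => y; rewrite opprD addrA !nr2 !rdotE.
rewrite ?(rdotC _ y x) ?(rdotC _ y l) ?(rdotC _ l x); lra.
Qed.

(** Project on the closure of W: the residual is orthogonal to W. *)
Lemma dense_subspace W : Defs.subspace W ->
  (forall y, (forall w, W w -> dot w y = 0) -> y = 0) -> forall x, near_set W x.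
Proof.
move=> [W0 Wlin] Wperp x.
have [||p Wp hp] := @projection (near_set W) x.
- split=> [e e0|c u v hu hv e e0]; first by exists 0; rewrite ?subrr ?nr0 ?ltW.
  have c0 : 0 < mdl c + 1 by rewrite ltr_wpDl.
  have [u' Wu' uu'] := hu (e / 2 / (mdl c + 1)) ltac:(by rewrite !divr_gt0).
  have [v' Wv' vv'] := hv (e / 2) ltac:(by rewrite divr_gt0).
  exists (c *: u' + v'); first exact: Wlin.
  rewrite opprD addrACA -scalerBr; apply: (le_trans (nrD _ _ _)); rewrite nrZ.
  have : mdl c * nr (u - u') <= e / 2.
    apply: (le_trans (ler_wpM2l (mdl_ge0 _) uu')).
    by rewrite mulrCA ger_pMr ?divr_gt0// ler_pdivrMr// mul1r lerDl.
  by move: vv'; lra.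
- move=> y hy e e0; have e2 : 0 < e / 2 by lra.
  have [w hw yw] := hy _ e2; have [v Wv wv] := hw _ e2; exists v => //.
  have -> : y - v = (y - w) + (w - v) by rewrite addrA subrK.
  by apply: (le_trans (nrD _ _ _)); lra.
have : x - p = 0.
  apply: Wperp => w Ww; rewrite dotC hp ?rmorph0// => e e0.
  by exists w; rewrite ?subrr ?nr0 ?ltW.
by move/eqP; rewrite subr_eq0 => /eqP ->.
Qed.

(** The representing vector is a multiple of the residual of the projection of
    some x with F x <> 0 on the kernel of F. *)
Lemma riesz (F : V -> R[i]) (C : R) :
  (forall c x y, F (c *: x + y) = c * F x + F y) ->
  (forall x, mdl (F x) <= C * nr x) -> exists y, forall x, F x = dot x y.
Proof.
move=> Flin Fb.
have F0 : F 0 = 0.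
  by have := Flin (-1) 0 0; rewrite scaler0 addr0 mulN1r addNr.
have FZ c x : F (c *: x) = c * F x by rewrite -[_ *: _]addr0 Flin F0 addr0.
have FB x y : F (x - y) = F x - F y.
  by rewrite addrC -scaleN1r Flin mulN1r addrC.
have [h|] := pselect (forall x, F x = 0).
  by exists 0 => x; rewrite dot0r h.
move=> /existsNP[x /eqP Fx].
have [||p /= Fp hp] := @projection [set y | F y = 0] x.
- by split=> [|c u v /= Fu Fv]; rewrite /= ?F0// Flin Fu Fv mulr0 addr0.
- move=> y hy /=; apply: contrapT => /eqP Fy.
  have m0 : 0 < mdl (F y) by rewrite -ltcR mdlE normr_gt0.
  have C0 : 0 < `|C| + 1 by rewrite ltr_wpDl.
  have [w /= Fw yw] := hy (mdl (F y) / 2 / (`|C| + 1)) ltac:(by rewrite !divr_gt0).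
  have := Fb (y - w); rewrite FB Fw subr0 => h.
  have : C * nr (y - w) <= mdl (F y) / 2.
    apply: (@le_trans _ _ ((`|C| + 1) * nr (y - w))).
      by apply: ler_wpM2r => //; have := ler_norm C; lra.
    by rewrite mulrC -ler_pdivlMr.
  lra.
pose e := x - p; have Fe : F e = F x by rewrite FB Fp subr0.
have e0 : e != 0 by apply: contra_neq Fx => e0; rewrite -Fe e0 F0.
have ee : dot e e != 0 by rewrite dnorm_eq0.
exists (Num.conj (F e / dot e e) *: e) => y.
rewrite dotZr conjCK.
have -> : dot y e = dot (y - (F y / F e) *: e) e + (F y / F e) * dot e e.
  by rewrite dotBl dotZl subrK.
have -> : dot (y - (F y / F e) *: e) e = 0.
  by rewrite dotC hp ?rmorph0//=; rewrite FB FZ divfK ?subrr// Fe.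
by field; rewrite ee Fe Fx.
Qed.

Lemma blin_adj f : blin dot f -> exists2 g, blin dot g & adj dot f g.
Proof.
move=> hf; have [C C0 Cf] := blin_pos hf.
have [y|g hg] := @choice V V (fun y z => forall x, dot (f x) y = dot x z).
  apply: (@riesz _ (C * nr y)) => [c u v|x].
    by rewrite (blin_lin hf) dotDl dotZl.
  apply: (le_trans (mdl_dot _ _ _)); rewrite mulrAC; exact: ler_wpM2r.
have fg : adj dot f g by move=> x y; exact: hg.
by exists g => //; exact: adj_blin fg hf.
Qed.

(** The range is dense by [dense_subspace]; along a convergent
    sequence in the range the preimages are Cauchy by the bound, and the graph is
    closed. Graphs of unbounded operators are allowed, as this is how the
    square roots of the two operators are inverted. *)
Lemma closed_range_onto (A : V -> V -> Prop) (C : R) :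
  (forall c u v u' v', A u v -> A u' v' -> A (c *: u + u') (c *: v + v')) ->
  A 0 0 ->
  (forall u v, (forall e : R, 0 < e -> exists u' v',
      [/\ A u' v', nr (u - u') <= e & nr (v - v') <= e]) -> A u v) ->
  (forall u v, A u v -> nr u <= C * nr v) ->
  (forall y, (forall u v, A u v -> dot v y = 0) -> y = 0) ->
  forall v, exists u, A u v.
Proof.
move=> Alin A00 Acl Ab Aperp v.
pose W := [set v | exists u, A u v].
have AB u v0 u' v' : A u v0 -> A u' v' -> A (u - u') (v0 - v').
  move=> h h'; have := Alin (-1) _ _ _ _ h' h.
  by rewrite !scaleN1r ![- _ + _]addrC.
have C0 : 0 < `|C| + 1 by rewrite ltr_wpDl.
have Ab' u v' : A u v' -> nr u <= (`|C| + 1) * nr v'.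
  move=> /Ab h; apply: (le_trans h); apply: ler_wpM2r => //.
  by have := ler_norm C; lra.
have Wsub : Defs.subspace W.
  split; first by exists 0.
  move=> c v0 v1 [u0 hu] [u1 hu'].
  by exists (c *: u0 + u1); exact: Alin.
have [|w hw vw] := near_setP (dense_subspace Wsub _ v).
  by move=> y hy; apply: Aperp => u v' Auv; apply: hy; exists u.
have [u hu] := choice hw.
have [|l hl] := nr_complete (u := u).
  move=> e e0; pose t := e / (2 * (`|C| + 1)).
  have t0 : 0 < t by rewrite divr_gt0// mulr_gt0.
  have [N hN] := inv_nat_lt t0; exists N => m n Nm Nn.
  apply: (le_trans (Ab' _ _ (AB _ _ _ _ (hu m) (hu n)))).
  have -> : w m - w n = (v - w n) - (v - w m).
    by rewrite opprB [RHS]addrC addrA subrK.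
  have : nr (v - w n - (v - w m)) <= 2 * t.
    apply: (le_trans (nrB_le _ _ _)).
    have := le_trans (vw n) (hN _ Nn); have := le_trans (vw m) (hN _ Nm); lra.
  move=> /(ler_wpM2l (ltW C0)) /le_trans; apply.
  by rewrite /t le_eqVlt; apply/orP; left; apply/eqP; field; rewrite gt_eqF.
exists l; apply: Acl => e e0.
have [N hN] := hl e e0; have [N' hN'] := inv_nat_lt e0.
pose n := maxn N N'; exists (u n), (w n); split=> //.
  by rewrite nrBC hN// leq_maxl.
by apply: (le_trans (vw n)); rewrite hN'// leq_maxr.
Qed.

End Projection.

(** * Hilbert-Schmidt sums *)

Section NonnegSums.
Context {R : realType} {T : choiceType}.
Implicit Types (E : set T) (F : T -> R).

Lemma esum_ge_seq E F (s : seq T) : uniq s -> (forall e, e \in s -> E e) ->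
  ((\sum_(e <- s) F e)%:E <= \esum_(e in E) (F e)%:E)%E.
Proof.
move=> us sE; apply: esum_ge; exists [set` s].
  by split; [exact: finite_seq|move=> e /=; exact: sE].
by rewrite -fsbig_seq// sumEFin.
Qed.

Lemma esum_le_seq E F (C : R) :
  (forall s : seq T, uniq s -> (forall e, e \in s -> E e) ->
     \sum_(e <- s) F e <= C) -> (\esum_(e in E) (F e)%:E <= C%:E)%E.
Proof.
move=> h; apply: ge_ereal_sup => _ [X [finX XE] <-].
rewrite fsbig_finite// sumEFin lee_fin; apply: h; first exact: fset_uniq.
by move=> e; rewrite in_fset_set// inE => /XE.
Qed.

Lemma esumZ E F (c : R) : 0 <= c -> (forall e, 0 <= F e) ->
  (\esum_(e in E) (c * F e)%:E = c%:E * \esum_(e in E) (F e)%:E)%E.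
Proof.
move=> c0 F0; have [->|cn0] := eqVneq c 0.
  by rewrite mul0e esum1// => e _; rewrite mul0r.
have cp : 0 < c by rewrite lt0r cn0.
have key (d : R) G : 0 < d -> (\esum_(e in E) (d * G e)%:E <=
    d%:E * \esum_(e in E) (G e)%:E)%E.
  move=> d0; apply: ge_ereal_sup => _ [X [finX XE] <-].
  rewrite fsbig_finite// sumEFin -mulr_sumr EFinM; apply: lee_wpmul2l.
    by rewrite lee_fin ltW.
  apply: esum_ge_seq; first exact: fset_uniq.
  by move=> e; rewrite in_fset_set// inE => /XE.
apply/eqP; rewrite eq_le key//=.
have := key c^-1 (fun e => c * F e); rewrite invr_gt0 => /(_ cp) h.
rewrite -lee_pdivlMl//; apply: le_trans h.
by apply: le_esum => e _; rewrite mulrA mulVf// mul1r.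
Qed.

End NonnegSums.

Lemma esum_swap (R : realType) (T T' : choiceType) (I : set T) (J : set T')
    (a : T -> T' -> \bar R) : (forall i j, 0 <= a i j)%E ->
  (\esum_(i in I) \esum_(j in J) a i j = \esum_(j in J) \esum_(i in I) a i j)%E.
Proof.
have key (S S' : choiceType) (A : set S) (B : set S') (b : S -> S' -> \bar R) :
    (forall i j, 0 <= b i j)%E ->
    (\esum_(i in A) \esum_(j in B) b i j <= \esum_(j in B) \esum_(i in A) b i j)%E.
  move=> b0; apply: ge_ereal_sup => _ [X [finX XA] <-].
  rewrite fsbig_finite// -esum_sum//; apply: le_esum => j Bj.
  apply: esum_ge; exists X => //.
  by rewrite fsbig_finite.
by move=> a0; apply/eqP; rewrite eq_le !key.
Qed.

Section HilbertSchmidt.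
Context {R : realType} {V : completeNormedModType R[i]}.
Variable dot : {dot V for Num.conj}.
Hypothesis dotV : induces_norm dot.
Local Notation nr := (dot_norm dot).
Local Notation rdot := (re_dot dot).
Local Notation blin := (blin dot).
Local Notation adj := (adj dot).
Implicit Types (x y z : V) (f g : V -> V).

(** z is orthogonal to s, hence to the sum, so |z|^2 = <z, x>, which is the
    difference on the right. *)
Lemma bessel_eq E (s : seq V) x : orthonormal_basis dot E -> uniq s ->
  (forall e, e \in s -> E e) ->
  let z := x - \sum_(e <- s) dot x e *: e in
  (forall e, e \in s -> dot z e = 0) /\
  nr z ^+ 2 = nr x ^+ 2 - \sum_(e <- s) mdl (dot x e) ^+ 2.
Proof.
move=> [Eon _] us sE z.
have ze e : e \in s -> dot z e = 0.
  move=> es; have ee : dot e e = 1 by rewrite Eon ?eqxx//; exact: sE.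
  rewrite dotBl dot_suml (bigD1_seq e)//= dotZl ee mulr1.
  rewrite big_seq_cond big1 ?addr0 ?subrr// => f /andP[fs fe].
  by rewrite dotZl (Eon _ _ (sE _ fs) (sE _ es)) (negbTE fe) mulr0.
split=> //; have zp : dot (\sum_(e <- s) dot x e *: e) z = 0.
  rewrite dot_suml big_seq big1// => e es.
  by rewrite dotZl [X in _ * X]dotC (ze _ es) rmorph0 mulr0.
apply: complexI; rewrite !nr2 rmorphB/= -!dotxx [LHS]dotBl zp subr0 {1}/z dotBr.
congr (_ - _); rewrite dot_sumr rmorph_sum/=; apply: eq_bigr => e _.
by rewrite mdl2 dotZr mulrC.
Qed.

(** Bessel's inequality bounds the finite sums. Conversely the span of E is
    dense, and no element of the span of a finite part s of E is closer to x than
    the projection of x on it. The span is described by duality, through vectors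
    orthogonal to s, so that no coefficients have to be handled. *)
Lemma parseval E x : orthonormal_basis dot E ->
  (\esum_(e in E) (mdl (dot x e) ^+ 2)%:E = (nr x ^+ 2)%:E)%E.
Proof.
move=> Eon; apply/eqP; rewrite eq_le; apply/andP; split.
  apply: esum_le_seq => s us sE; have [_ h] := bessel_eq x Eon us sE.
  by rewrite -subr_ge0 -h sqr_ge0.
pose W := [set w | exists2 s : seq V, uniq s /\ (forall e, e \in s -> E e) &
  forall z, (forall e, e \in s -> dot z e = 0) -> dot z w = 0].
have Wsub : Defs.subspace W.
  split; first by exists [::] => // z _; rewrite dot0r.
  move=> c u v [s [us sE] hs] [t [ut tE] ht]; exists (undup (s ++ t)).
    split=> [|e]; first exact: undup_uniq.
    by rewrite mem_undup mem_cat => /orP[/sE|/tE].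
  move=> z hz; rewrite dotDr dotZr hs ?ht ?mulr0 ?addr0// => e es; apply: hz;
    by rewrite mem_undup mem_cat es ?orbT.
have Wd y : (forall w, W w -> dot w y = 0) -> y = 0.
  move=> h; apply: Eon.2 => e Ee; rewrite dotC h ?rmorph0//.
  exists [:: e] => [|z hz]; last by apply: hz; rewrite inE.
  by split=> // f; rewrite inE => /eqP ->.
apply/lee_addgt0Pr => r r0.
pose t := Num.min 1 r.
have t0 : 0 < t by rewrite lt_min ltr01.
have [w [s [us sE] hw] xw] := dense_subspace dotV Wsub Wd x t0.
have [ze h] := bessel_eq x Eon us sE; set z := (x - _) in ze h.
have zw : nr z <= nr (x - w).
  have [->|z0] := eqVneq z 0; first by rewrite nr0.
  rewrite -(ler_pM2l (nr_gt0 dot z0)) -expr2 nr2; apply: le_trans (rdot_CS _ _ _).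
  suff -> : rdot z z = rdot z (x - w) by [].
  have zw0 : rdot z w = 0 by rewrite /re_dot hw.
  have zp0 : rdot z (\sum_(e <- s) dot x e *: e) = 0.
    rewrite /re_dot dot_sumr big_seq big1// => e es.
    by rewrite dotZr ze ?mulr0.
  by rewrite [in RHS]rdotDr rdotNr zw0 {2}/z rdotDr rdotNr zp0.
apply: (@le_trans _ _ ((\sum_(e <- s) mdl (dot x e) ^+ 2)%:E + r%:E)%E); last first.
  by rewrite leeD2r//; exact: esum_ge_seq.
rewrite -EFinD lee_fin; have : nr z ^+ 2 <= t ^+ 2.
  by rewrite ler_sqr ?nnegrE ?(ltW t0)//; exact: le_trans zw xw.
have : t ^+ 2 <= r.
  have tr : t <= r by rewrite ge_min lexx orbT.
  by apply: le_trans tr; rewrite expr2 ler_piMl ?(ltW t0)// ge_min lexx.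
rewrite h; lra.
Qed.

Definition hs_square f : \bar R := (\esum_(e in onb dot) (nr (f e) ^+ 2)%:E)%E.
Local Notation hs2 := hs_square.

Lemma onbP : orthonormal_basis dot (onb dot).
Proof. exact: xgetPex (orthonormal_basis_exists dot). Qed.

Lemma hs2_ge0 f : (0 <= hs2 f)%E.
Proof. by apply: esum_ge0 => e _; rewrite lee_fin sqr_ge0. Qed.

(** Both sides are the double sum of |dot (f e) e'|^2 by Parseval's identity. *)
Lemma hs2_adj f g : adj f g -> hs2 f = hs2 g.
Proof.
move=> fg; rewrite /hs_square.
under eq_esum do rewrite -(parseval _ onbP).
under [RHS]eq_esum do rewrite -(parseval _ onbP).
rewrite esum_swap => [|i j]; last by rewrite lee_fin sqr_ge0.
apply: eq_esum => e _; apply: eq_esum => e' _.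
by rewrite fg dotC /mdl norm_conjC.
Qed.

Lemma hs2_scale_le f g (C : R) : 0 <= C -> (forall x, nr (f x) <= C * nr (g x)) ->
  (hs2 f <= (C ^+ 2)%:E * hs2 g)%E.
Proof.
move=> C0 h; rewrite /hs_square -esumZ ?sqr_ge0//; last by move=> e; rewrite sqr_ge0.
apply: le_esum => e _; rewrite lee_fin -exprMn ler_sqr ?nnegrE//.
exact: mulr_ge0.
Qed.

(** Passing to adjoints turns the right factor into a left one. *)
Lemma hs2_mulr f f' g g' (C : R) : 0 <= C -> adj f f' -> adj g g' ->
  bounded_by dot C g -> (hs2 (f \o g) <= (C ^+ 2)%:E * hs2 f)%E.
Proof.
move=> C0 ff' gg' gC; rewrite (hs2_adj (adj_comp ff' gg')) (hs2_adj ff').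
by apply: hs2_scale_le => // x; exact: adj_bounded gg' gC _.
Qed.

Lemma hs2_eq_nr f g : (forall x, nr (f x) = nr (g x)) -> hs2 f = hs2 g.
Proof. by move=> h; apply: eq_esum => e _; rewrite h. Qed.

End HilbertSchmidt.

(** * Square roots and spectral gaps *)

Section Symmetric.
Context {R : realType} {V : completeNormedModType R[i]}.
Variable dot : {dot V for Num.conj}.
Local Notation nr := (dot_norm dot).
Local Notation rdot := (re_dot dot).
Local Notation blin := (blin dot).
Local Notation adj := (adj dot).
Implicit Types (x y z : V) (f g a q : V -> V).

Definition nonneg_op f := forall x, 0 <= rdot (f x) x.
Definition inj0 f := forall x, f x = 0 -> x = 0.

(** The Cauchy-Schwarz inequality for the form <f x, y>, at y = f x. *)
Lemma nonneg_CS f (L : R) x : adj f f -> nonneg_op f -> linear f ->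
  0 <= L -> bounded_by dot L f -> nr (f x) ^+ 2 <= L * rdot (f x) x.
Proof.
move=> fs f0 fl L0 fL.
have [->|fx0] := eqVneq (f x) 0; first by rewrite nr0 rdot0l expr0n mulr0.
have h : rdot (f x) (f x) ^+ 2 <= rdot (f (f x)) (f x) * rdot (f x) x.
  apply: discriminant_le; first exact: f0.
  move=> t; have := f0 (t%:C *: f x + x); rewrite (linD fl) (linZ fl) !rdotE.
  rewrite (adj_rdot fs (f x) x); congr (_ <= _); ring.
have h2 : rdot (f (f x)) (f x) <= L * nr (f x) ^+ 2.
  apply: (le_trans (rdot_CS _ _ _)); rewrite expr2 mulrA.
  by apply: ler_wpM2r => //; exact: fL.
have p : 0 < nr (f x) ^+ 2 by rewrite exprn_gt0// nr_gt0.
rewrite -(ler_pM2l p) -expr2 mulrCA mulrA; rewrite -nr2 in h.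
by apply: (le_trans h); apply: ler_wpM2r => //; exact: f0.
Qed.

(** An operator commuting with a^2 commutes with a: the commutator C satisfies
    a C = - C a, so (1 + e a)^k C = C (1 - e a)^k stays bounded in k, whereas
    the powers of 1 + e a grow on every nonzero vector. *)
Lemma commute_sqrt a q : blin a -> adj a a -> nonneg_op a -> inj0 a -> blin q ->
  (forall x, q (a (a x)) = a (a (q x))) -> forall x, q (a x) = a (q x).
Proof.
move=> ab as_ a0 ainj qb qaa.
have al := blin_lin ab; have ql := blin_lin qb.
pose C x := q (a x) - a (q x).
have Cb : blin C by apply: blin_sub; [exact: blin_comp qb ab|exact: blin_comp ab qb].
have aC x : a (C x) = - C (a x).
  by rewrite /C (linB al) opprB qaa.
have [L L0 aL] := blin_pos ab; have [c c0 Cc] := blin_pos Cb.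
pose e := L^-1; have e0 : 0 < e by rewrite invr_gt0.
pose U x := x + e%:C *: a x; pose D x := x - e%:C *: a x.
have UC x : U (C x) = C (D x).
  rewrite /U /D aC scalerN (linB (blin_lin Cb)) (linZ (blin_lin Cb)).
  by [].
have nD x : nr (D x) <= nr x.
  rewrite ler_nr /D !rdotE (rdotC _ x (a x)).
  have := ler_wpM2l (ltW e0) (nonneg_CS x as_ a0 al (ltW L0) aL).
  rewrite [leRHS]mulrA {2}/e mulVf ?gt_eqF// mul1r nr2 => h; have ee : e * (e * rdot (a x) (a x)) <= e * rdot (a x) x.
    by rewrite ler_pM2l.
  have := a0 x; have := mulr_ge0 (ltW e0) (a0 x).
  lra.
have nDk k x : nr (iter k D x) <= nr x.
  by elim: k => //= k; apply: le_trans; exact: nD.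
have UCk k x : iter k U (C x) = C (iter k D x).
  by elim: k => //= k ->; rewrite UC.
have aU x : rdot (a x) x <= rdot (a (U x)) (U x) /\
    nr x ^+ 2 + 2 * e * rdot (a x) x <= nr (U x) ^+ 2.
  rewrite /U (linD al) (linZ al) !nr2 !rdotE (adj_rdot as_ (a x) x).
  rewrite (rdotC _ x (a x)); have := a0 (a x); have := rdot_ge0 dot (a x).
  set p := rdot (a x) (a x); set r := rdot (a (a x)) (a x) => hp hr.
  have := mulr_ge0 (ltW e0) hp; have := mulr_ge0 (ltW e0) (mulr_ge0 (ltW e0) hp).
  have := mulr_ge0 (ltW e0) (mulr_ge0 (ltW e0) hr).
  by split; lra.
have grow k x : rdot (a x) x <= rdot (a (iter k U x)) (iter k U x) /\
    nr x ^+ 2 + k%:R * (2 * e * rdot (a x) x) <= nr (iter k U x) ^+ 2.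
  elim: k => [|k [ih1 ih2]] /=; first by rewrite mul0r addr0.
  have [h1 h2] := aU (iter k U x); split; first exact: le_trans ih1 h1.
  apply: le_trans h2; rewrite -natr1 mulrDl mul1r addrA lerD//.
  by rewrite ler_pM2l// mulr_gt0.
(* Otherwise <a (C z), C z> would be positive and the bound of grow would exceed
   the uniform bound of the powers. *)
suff Cz z : C z = 0 by move=> x; apply/eqP; rewrite -subr_eq0; apply/eqP/Cz.
have : rdot (a (C z)) (C z) <= 0.
  rewrite leNgt; apply/negP => h.
  pose B := (c * nr z) ^+ 2; pose s := 2 * e * rdot (a (C z)) (C z).
  have s0 : 0 < s by rewrite !mulr_gt0.
  have := archi_boundP (divr_ge0 (sqr_ge0 _) (ltW s0) : 0 <= B / s).
  set k := Num.bound _; rewrite ltr_pdivrMr//; apply/negP; rewrite -leNgt.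
  have [_ /le_trans gk] := grow k (C z); apply: le_trans (gk B _).
    by rewrite lerDr sqr_ge0.
  rewrite UCk ler_sqr ?nnegrE ?mulr_ge0 ?(ltW c0)//.
  by apply: (le_trans (Cc _)); rewrite ler_pM2l.
move=> h; apply: ainj; apply: (@nr_eq0 _ _ dot); apply/eqP.
rewrite -sqrf_eq0 eq_le sqr_ge0 andbT.
apply: (le_trans (nonneg_CS (C z) as_ a0 al (ltW L0) aL)).
by rewrite pmulr_rle0.
Qed.

Lemma projection_le q x : adj q q -> (forall y, q (q y) = q y) -> nr (q x) <= nr x.
Proof.
move=> qs qq; have [->|q0] := eqVneq (q x) 0; first by rewrite nr0.
rewrite -(ler_pM2l (nr_gt0 dot q0)) -expr2 nr2 (adj_rdot qs) qq rdotC.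
exact: rdot_CS.
Qed.

(** The approximate point spectrum of the restriction of f^-1 to the range of q:
    with u = f z, the negated condition is |u| <= c |(f^-1 - l) u|. Selfadjoint
    operators have no other spectrum, and this form of the condition refers only
    to the bounded operator f. *)
Definition inv_spec f q (l : R) := ~ exists c : R, forall z, q z = z ->
  nr (f z) <= c * nr (z - l%:C *: f z).

Definition oproj q := [/\ blin q, adj q q & forall x, q (q x) = q x].

Lemma inv_spec_ge f q (C l : R) : adj f f -> nonneg_op f -> 0 < C ->
  bounded_by dot C f -> inv_spec f q l -> C^-1 <= l.
Proof.
move=> fs f0 C0 fC; apply: contra_notP => /negP; rewrite -ltNge => lC.
have [l0|l0] := leP 0 l.
  have k : 0 < C^-1 - l by rewrite subr_gt0.
  exists (C^-1 - l)^-1 => z _; rewrite mulrC ler_pdivlMr// mulrBr.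
  have := nrB_ge dot z (l%:C *: f z); rewrite nrZR ger0_norm// => h.
  apply: le_trans h; rewrite [l * _]mulrC lerD2r ler_pdivrMr// mulrC.
  exact: fC.
exists C => z _; apply: (le_trans (fC z)); rewrite ler_pM2l// ler_nr.
rewrite !rdotE (rdotC _ z (f z)); have := mulr_ge0 (ltW (_ : 0 < - l)) (f0 z).
rewrite oppr_gt0 => /(_ l0); have : 0 <= l * (l * rdot (f z) (f z)).
  by rewrite mulrA -expr2 mulr_ge0 ?sqr_ge0.
by lra.
Qed.

(** Let m be the largest constant with m |f y| <= |(1 - l f) y| on the range of q.
    Then F = (1 - l f)^2 - m^2 f^2 is nonnegative there, but there are y with F y
    arbitrarily small compared to f y. It factors as
    (1 - (l + m) f) (1 - (l - m) f), so l + m or l - m is in the spectrum, and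
    m < d is witnessed by z. *)
Lemma spectral_gap f q (l d : R) z : blin f -> adj f f -> inj0 f -> oproj q ->
  (forall x, f (q x) = q (f x)) -> q z = z -> z != 0 ->
  nr (z - l%:C *: f z) < d * nr (f z) ->
  exists2 l', inv_spec f q l' & `|l' - l| < d.
Proof.
move=> fb fs finj [qb qs qq] fq qz z0 zd.
have fl := blin_lin fb; have ql := blin_lin qb.
pose T (s : R) y := y - s%:C *: f y.
have fn0 y : y != 0 -> 0 < nr (f y).
  by move=> y0; apply: nr_gt0; apply: contra_neq y0; exact: finj.
pose D := [set nr (T l y) / nr (f y) | y in [set y | q y = y /\ y != 0]].
have D0 : D !=set0 by exists (nr (T l z) / nr (f z)), z.
have Dlb : has_lbound D.
  by exists 0 => _ [y _ <-]; rewrite divr_ge0.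
pose m := inf D.
have m0 : 0 <= m by apply: lb_le_inf => // _ [y _ <-]; rewrite divr_ge0.
have md : m < d.
  apply: (@le_lt_trans _ _ (nr (T l z) / nr (f z))).
    by apply: ge_inf => //; exists z.
  by rewrite ltr_pdivrMr ?fn0.
have mle y : q y = y -> m * nr (f y) <= nr (T l y).
  move=> qy; have [->|y0] := eqVneq y 0; first by rewrite (lin0 fl) nr0 mulr0.
  by rewrite -ler_pdivlMr ?fn0//; apply: ge_inf => //; exists y.
have [h|h1] := pselect (inv_spec f q (l + m)).
  by exists (l + m) => //; rewrite addrAC subrr add0r ger0_norm.
have [h|h2] := pselect (inv_spec f q (l - m)).
  by exists (l - m) => //; rewrite addrAC subrr add0r normrN ger0_norm.
exfalso.
have pos s : ~ inv_spec f q s -> exists2 c : R, 0 < c & forall y, q y = y ->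
    nr (f y) <= c * nr (T s y).
  move=> /contrapT[c hc]; exists (`|c| + 1) => [|y qy]; first by rewrite ltr_wpDl.
  apply: (le_trans (hc y qy)); apply: ler_wpM2r => //.
  by have := ler_norm c; lra.
have [c1 c10 hc1] := pos _ h1; have [c2 c20 hc2] := pos _ h2.
have Tb s : blin (T s) by apply: blin_sub; [exact: blin_id|exact: blin_scale].
have Ts s : adj (T s) (T s).
  by move=> x y; rewrite /T dotBl dotBr dotZl dotZr conjR fs.
have TT s s' x : T s (T s' x) = T s' (T s x).
  rewrite /T !(linB fl) !(linZ fl).
  by apply: (@rdot_inj _ _ dot) => u; rewrite !rdotE; ring.
have Tf s x : f (T s x) = T s (f x) by rewrite /T (linB fl) (linZ fl).
have Tq s x : T s (q x) = q (T s x).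
  by rewrite /T (linB ql) (linZ ql) fq.
pose F x := T (l + m) (T (l - m) (q x)).
have Fb : blin F.
  exact: blin_comp (Tb _) (blin_comp (Tb _) qb).
have Fs : adj F F.
  by move=> x y; rewrite /F Ts Ts qs !Tq TT.
have FE y : q y = y -> rdot (F y) y = nr (T l y) ^+ 2 - m ^+ 2 * nr (f y) ^+ 2.
  move=> qy; rewrite /F qy (adj_rdot (Ts _)) !nr2 /T !rdotE.
  by rewrite (rdotC _ y (f y)); ring.
have F0 : nonneg_op F.
  move=> x; have -> : rdot (F x) x = rdot (F (q x)) (q x).
    by rewrite -(adj_rdot qs) {2}/F qq -!Tq qq.
  rewrite FE ?qq// -exprMn subr_ge0 ler_sqr ?nnegrE ?mulr_ge0//.
  exact: mle.
have [L L0 FL] := blin_pos Fb.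
have key (t : R) : 0 < t -> t <= 1 -> exists y, [/\ q y = y, y != 0 &
    nr (F y) ^+ 2 <= L * (2 * m + 1) * t * nr (f y) ^+ 2].
  move=> t0 t1; have [_ [y [qy y0] <-]] := inf_adherent t0 (conj D0 Dlb).
  rewrite -/m ltr_pdivrMr ?fn0// => hy; exists y; split=> //.
  apply: (le_trans (nonneg_CS y Fs F0 (blin_lin Fb) (ltW L0) FL)).
  rewrite FE// -!mulrA ler_pM2l//.
  have : nr (T l y) ^+ 2 <= ((m + t) * nr (f y)) ^+ 2.
    by rewrite ler_sqr ?nnegrE ?mulr_ge0 ?addr_ge0// ltW.
  rewrite exprMn => h; have : t ^+ 2 * nr (f y) ^+ 2 <= t * nr (f y) ^+ 2.
    by apply: ler_wpM2r; [exact: sqr_ge0|rewrite expr2 ler_piMl// ltW].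
  have : (m + t) ^+ 2 * nr (f y) ^+ 2 = m ^+ 2 * nr (f y) ^+ 2 + 2 * (m * (t * nr (f y) ^+ 2)) + t ^+ 2 * nr (f y) ^+ 2 by ring.
  move: h; lra.
(* Rescaled so that the bound is on the norm instead of its square. *)
have key2 (t : R) : 0 < t -> exists y, [/\ q y = y, y != 0 & nr (F y) <= t * nr (f y)].
  move=> t0; pose K := L * (2 * m + 1).
  have K0 : 0 < K by rewrite mulr_gt0//; lra.
  have [||y [qy y0 hy]] := key (Num.min 1 (t ^+ 2 / K)).
  - by rewrite lt_min ltr01 divr_gt0// exprn_gt0.
  - by rewrite ge_min lexx.
  exists y; split=> //.
  rewrite -(ler_pXn2r (_ : 0 < 2)%N) ?nnegrE ?mulr_ge0 ?(ltW t0)//.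
  apply: (le_trans hy); rewrite exprMn; apply: ler_wpM2r; first exact: sqr_ge0.
  by rewrite -/K mulrC -ler_pdivlMr// ge_min lexx orbT.
(* If both factors of F were bounded below, F y small would make f (f y) small;
   then y is bounded by K0 times f y, and |f y|^2 = <y, f (f y)> is small
   compared to |f y|^2. *)
pose K0 := 1 + 2 * `|l| + `|l ^+ 2 - m ^+ 2| * (c2 * c1).
have K01 : 1 <= K0.
  by rewrite /K0 -addrA lerDl addr_ge0 ?mulr_ge0// ltW.
have K00 : 0 < K0 by exact: lt_le_trans K01.
pose t := Num.min 1 (2 * (K0 * (c2 * c1)))^-1.
have t0 : 0 < t by rewrite lt_min ltr01 invr_gt0 !mulr_gt0.
have t1 : t <= 1 by rewrite ge_min lexx.
have tK : t * (K0 * (c2 * c1)) <= 2^-1.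
  rewrite -ler_pdivlMr ?mulr_gt0// -invfM ge_min lexx orbT//.
have [y [qy y0 Fy]] := key2 t t0.
have fy0 := fn0 y y0.
have ffy : nr (f (f y)) <= c2 * c1 * t * nr (f y).
  have qfy : q (f y) = f y by rewrite -fq qy.
  apply: (le_trans (hc2 _ qfy)); rewrite -!mulrA ler_pM2l// -Tf.
  have qTy : q (T (l - m) y) = T (l - m) y by rewrite -Tq qy.
  apply: (le_trans (hc1 _ qTy)); rewrite ler_pM2l//.
  by move: Fy; rewrite /F qy.
have yle : nr y <= K0 * nr (f y).
  have yE : y = F y + (2 * l)%:C *: f y - (l ^+ 2 - m ^+ 2)%:C *: f (f y).
    rewrite /F qy /T (linB fl) (linZ fl) scalerBr scalerA -!rmorphM/=.
    apply: (@rdot_inj _ _ dot) => x; rewrite !rdotE; ring.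
  rewrite {1}yE; apply: (le_trans (nrB_le _ _ _)); rewrite nrZR.
  apply: (le_trans (lerD (nrD _ _ _) (lexx _))); rewrite nrZR normrM (ger0_norm (ler0n _ 2)).
  have : `|l ^+ 2 - m ^+ 2| * nr (f (f y)) <= `|l ^+ 2 - m ^+ 2| * (c2 * c1) * nr (f y).
    rewrite -!mulrA ler_wpM2l//; apply: (le_trans ffy); rewrite -!mulrA.
    by rewrite !ler_pM2l// ger_pMl.
  have : t * nr (f y) <= nr (f y) by rewrite ger_pMl.
  by rewrite /K0 !mulrDl mul1r; move: Fy; lra.
have : nr (f y) ^+ 2 <= 2^-1 * nr (f y) ^+ 2.
  rewrite {1}nr2 (adj_rdot fs); apply: (le_trans (rdot_CS _ _ _)).
  apply: (le_trans (ler_pM (nr_ge0 _ _) (nr_ge0 _ _) yle ffy)).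
  have -> : K0 * nr (f y) * (c2 * c1 * t * nr (f y)) = t * (K0 * (c2 * c1)) * nr (f y) ^+ 2 by ring.
  by apply: ler_wpM2r => //; exact: sqr_ge0.
have : 0 < nr (f y) ^+ 2 by rewrite exprn_gt0.
lra.
Qed.

End Symmetric.

(** * Consequences of the relative gap *)

Section RelativeGap.
Context {R : realType} {V : completeNormedModType R[i]}.
Variable dot : {dot V for Num.conj}.
Local Notation nr := (dot_norm dot).
Local Notation rdot := (re_dot dot).
Local Notation blin := (blin dot).
Local Notation adj := (adj dot).
Local Notation oproj := (oproj dot).
Local Notation inv_spec := (inv_spec dot).
Implicit Types (x y z w : V) (a b p q : V -> V).

Definition posop a := [/\ blin a, adj a a, nonneg_op dot a & inj0 a].
Definition sq a x : V := a (a x).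

Lemma sq_rdot a x : posop a -> rdot (sq a x) x = nr (a x) ^+ 2.
Proof. by case=> _ as_ _ _; rewrite /sq (adj_rdot as_) nr2. Qed.

Lemma sq_blin a : posop a -> blin (sq a).
Proof. by case=> ab _ _ _; exact: (blin_comp ab ab). Qed.

Lemma sq_adj a : posop a -> adj (sq a) (sq a).
Proof. by case=> _ as_ _ _ x y; rewrite /sq !as_. Qed.

Lemma sq_nonneg a : posop a -> nonneg_op dot (sq a).
Proof. by move=> ha x; rewrite sq_rdot// sqr_ge0. Qed.

Lemma sq_inj0 a : posop a -> inj0 (sq a).
Proof. by case=> _ _ _ ai x /ai/ai. Qed.

Section Gap.
Variables (a b p q : V -> V) (g : R).
Hypotheses (ha : posop a) (hb : posop b) (hp : oproj p) (hq : oproj q).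
Hypotheses (aq : forall x, a (q x) = q (a x)) (bp : forall x, b (p x) = p (b x)).
Hypothesis g0 : 0 < g.
Hypothesis gapP : forall l m, inv_spec (sq a) q l -> inv_spec (sq b) p m ->
  g * Num.sqrt (l * m) <= `|l - m|.

(** The m with |l - m| < g sqrt (l m) form an interval with center c l and
    radius r l, where c = 1 + g^2 / 2 and r^2 = c^2 - 1. It is free of spectrum,
    so |(1 - c l b^2) w| >= r l |b^2 w|; expanding the square of this inequality
    gives the square of the conclusion. *)
Lemma relative_gap l w : inv_spec (sq a) q l -> p w = w ->
  g * Num.sqrt l * nr (b w) <= nr (w - l%:C *: sq b w).
Proof.
move=> hl pw; rewrite leNgt; apply/negP => lt_w.
have [C C0 aC] := blin_pos (sq_blin ha).
have l0 : 0 < l.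
  apply: lt_le_trans (inv_spec_ge (sq_adj ha) (sq_nonneg ha) C0 aC hl).
  by rewrite invr_gt0.
have w0 : w != 0.
  apply: contraTneq lt_w => ->.
  have [/blin_lin bl _ _ _] := hb; rewrite /sq !(lin0 bl) scaler0 subrr nr0 mulr0.
  by rewrite ltxx.
pose c := 1 + g ^+ 2 / 2; pose r := Num.sqrt (c ^+ 2 - 1).
have g20 : 0 < g ^+ 2 by rewrite exprn_gt0.
have r2 : r ^+ 2 = c ^+ 2 - 1.
  rewrite sqr_sqrtr// /c; have := sqr_ge0 (g ^+ 2 / 2); rewrite sqrrD expr1n; lra.
have r0 : 0 <= r by exact: sqrtr_ge0.
have lt2 : nr (w - l%:C *: sq b w) ^+ 2 < g ^+ 2 * l * nr (b w) ^+ 2.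
  rewrite -[X in _ * X * _](sqr_sqrtr (ltW l0)) -!exprMn.
  by rewrite ltr_sqr ?nnegrE ?mulr_ge0 ?sqrtr_ge0 ?(ltW g0).
have [||m hm] := @spectral_gap _ _ dot (sq b) p (c * l) (r * l) w (sq_blin hb) (sq_adj hb)
    (sq_inj0 hb) hp _ pw w0.
- by move=> x; rewrite /sq !bp.
- rewrite -(ltr_pXn2r (_ : 0 < 2)%N) ?nnegrE ?mulr_ge0 ?(ltW l0)//.
  rewrite exprMn [(r * l) ^+ 2]exprMn r2 !nr2 !rdotE (rdotC _ w (sq b w)).
  rewrite sq_rdot//; move: lt2; rewrite [X in X < _]nr2 !rdotE (rdotC _ w (sq b w)).
  rewrite sq_rdot// /c; set t := rdot (sq b w) (sq b w); set u := _ ^+ 2.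
  by rewrite !expr2; lra.
rewrite -(ltr_pXn2r (_ : 0 < 2)%N) ?nnegrE ?mulr_ge0 ?(ltW l0)//.
rewrite real_normK ?num_real// exprMn r2 => h.
have h2 : (l - m) ^+ 2 < g ^+ 2 * (l * m).
  by move: h; rewrite /c !expr2; lra.
have lm0 : 0 <= l * m.
  by have := le_lt_trans (sqr_ge0 _) h2; rewrite pmulr_rgt0// => /ltW.
have := gapP hl hm; rewrite -(ler_pXn2r (_ : 0 < 2)%N) ?nnegrE ?mulr_ge0 ?sqrtr_ge0 ?(ltW g0)//.
by rewrite real_normK ?num_real// exprMn sqr_sqrtr// leNgt h2.
Qed.

(** Either n is close to some 1/l with l in the spectrum of the inverse of a^2, and
    then the previous inequality holds at n with a slightly smaller constant, or
    a^2 - n is bounded below on the range of q. The bound d is uniform as long as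
    n stays away from 0. *)
Lemma gap_dichotomy (g' t : R) : 0 < g' -> g' < g -> 0 < t ->
  exists2 d : R, 0 < d & forall n : R, t <= `|n| ->
    (0 < n /\ forall w, p w = w -> g' * Num.sqrt n * nr (b w) <= nr (sq b w - n%:C *: w)) \/
    (forall z, q z = z -> d * nr z <= nr (sq a z - n%:C *: z)).
Proof.
move=> g'0 g'g t0.
have [C C0 aC] := blin_pos (sq_blin ha).
have [bb _ _ _] := hb; have [D D0 bD] := blin_pos bb.
have gD : 0 < g' + D by rewrite addr_gt0.
have sC : 0 < Num.sqrt C by rewrite sqrtr_gt0.
(* The spectral point l' will be within s^2 of l = 1/n; since l' >= 1/C, passing
   from l' to l then costs at most (g - g') sqrt l'. *)
pose s := Num.min 1 ((g - g') / (Num.sqrt C * (g' + D))).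
have s0 : 0 < s by rewrite lt_min ltr01 divr_gt0 ?subr_gt0// mulr_gt0.
have s1 : s <= 1 by rewrite ge_min lexx.
have sg : s * (g' + D) <= (g - g') / Num.sqrt C.
  rewrite -ler_pdivlMr// -mulrA -invfM ge_min; apply/orP; right.
  by [].
pose d := Num.min (t / 2) (s ^+ 2 * t ^+ 2 / 2).
have d0 : 0 < d by rewrite lt_min !divr_gt0// mulr_gt0// exprn_gt0.
have dt : d <= t / 2 by rewrite ge_min lexx.
have ds : d <= s ^+ 2 * t ^+ 2 / 2 by rewrite ge_min lexx orbT.
exists d => // n tn; have [n0|n0] := ltP 0 n; last first.
  right => z _; have : t * nr z <= nr (sq a z - n%:C *: z).
    apply: (@le_trans _ _ (`|n| * nr z)); first by apply: ler_wpM2r.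
    rewrite -(ler_pXn2r (_ : 0 < 2)%N) ?nnegrE ?mulr_ge0//.
    rewrite exprMn real_normK ?num_real// !nr2 !rdotE (rdotC _ z (sq a z)).
    have := mulr_ge0 (_ : 0 <= - n) (sq_nonneg ha z); rewrite oppr_ge0 => /(_ n0).
    by have := rdot_ge0 dot (sq a z); rewrite !expr2; lra.
  by apply: le_trans; apply: ler_wpM2r => //; lra.
rewrite gtr0_norm// in tn.
have [h|/existsNP[z /not_implyP[qz /negP]]] :=
    pselect (forall z, q z = z -> d * nr z <= nr (sq a z - n%:C *: z)); first by right.
rewrite -ltNge => hz; left; split=> // w pw.
pose l := n^-1; have l0 : 0 < l by rewrite invr_gt0.
have nl : n * l = 1 by rewrite mulfV ?gt_eqF.
have z0 : z != 0.
  by apply: contraTneq hz => ->; rewrite nr0 mulr0 -leNgt.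
have zE : nr (z - l%:C *: sq a z) = l * nr (sq a z - n%:C *: z).
  rewrite -[X in X * _](gtr0_norm l0) -nrZR scalerBr scalerA -rmorphM/= mulrC nl.
  by rewrite scale1r nrBC.
have lt1 : l * t <= 1 by rewrite mulrC ler_pdivrMr// mul1r.
have za : n / 2 * nr z <= nr (sq a z).
  have := nrB_ge dot (n%:C *: z) (sq a z); rewrite nrBC nrZR gtr0_norm//.
  have : d * nr z <= n / 2 * nr z by apply: ler_wpM2r => //; lra.
  by move: hz; lra.
have [||l' hl' ll'] := @spectral_gap _ _ dot (sq a) q l (s ^+ 2) z (sq_blin ha) (sq_adj ha)
    (sq_inj0 ha) hq _ qz z0.
- by move=> x; rewrite /sq !aq.
- rewrite zE; apply: (@lt_le_trans _ _ (l * (d * nr z))); first by rewrite ltr_pM2l.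
  apply: (@le_trans _ _ (s ^+ 2 * (n / 2 * nr z))); last first.
    by apply: ler_wpM2l => //; exact: sqr_ge0.
  rewrite !mulrA; apply: ler_wpM2r => //.
  apply: (@le_trans _ _ (l * (s ^+ 2 * t ^+ 2 / 2))); first by rewrite ler_pM2l.
  have -> : l * (s ^+ 2 * t ^+ 2 / 2) = s ^+ 2 / 2 * t * (l * t) by ring.
  apply: (@le_trans _ _ (s ^+ 2 / 2 * t)).
    by rewrite ger_pMr// mulr_gt0// divr_gt0// exprn_gt0.
  have -> : s ^+ 2 * n / 2 = s ^+ 2 / 2 * n by ring.
  by rewrite ler_pM2l// divr_gt0// exprn_gt0.
have l'C := inv_spec_ge (sq_adj ha) (sq_nonneg ha) C0 aC hl'.
have l'0 : 0 < l' by apply: lt_le_trans l'C; rewrite invr_gt0.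
have hw := relative_gap hl' pw.
have sl : Num.sqrt l <= Num.sqrt l' + s.
  rewrite -(ler_pXn2r (_ : 0 < 2)%N) ?nnegrE ?addr_ge0 ?sqrtr_ge0 ?(ltW s0)//.
  rewrite sqrrD (sqr_sqrtr (ltW l0)) (sqr_sqrtr (ltW l'0)).
  have : 0 <= Num.sqrt l' * s by rewrite mulr_ge0 ?sqrtr_ge0 ?(ltW s0).
  have := ler_norm (l - l'); rewrite distrC; lra.
have sl' : (g - g') / Num.sqrt C <= (g - g') * Num.sqrt l'.
  by rewrite ler_pM2l ?subr_gt0// -(sqrtrV (ltW C0)); exact: ler_wsqrtr.
have key : g' * Num.sqrt l * nr (b w) <= nr (w - l%:C *: sq b w).
  have -> : w - l%:C *: sq b w = (w - l'%:C *: sq b w) - (l - l')%:C *: sq b w.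
    by rewrite rmorphB/= scalerBl opprB addrA subrK.
  apply: le_trans (nrB_ge _ _ _); rewrite nrZR distrC.
  have h1 : `|l' - l| * nr (sq b w) <= s * D * nr (b w).
    rewrite -mulrA; apply: ler_pM => //; last exact: bD.
    by apply: (le_trans (ltW ll')); rewrite expr2 ger_pMr.
  have h2 : g' * Num.sqrt l * nr (b w) <= (g' * (Num.sqrt l' + s)) * nr (b w).
    by apply: ler_wpM2r => //; rewrite ler_pM2l.
  have h3 : (g' * (Num.sqrt l' + s) + s * D) * nr (b w) <= g * Num.sqrt l' * nr (b w).
    by apply: ler_wpM2r => //; lra.
  by move: h3; rewrite mulrDl; lra.
have -> : nr (sq b w - n%:C *: w) = n * nr (w - l%:C *: sq b w).
  rewrite -{2}(gtr0_norm n0) -nrZR scalerBr scalerA -rmorphM/= nl.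
  by rewrite scale1r nrBC.
have -> : g' * Num.sqrt n * nr (b w) = n * (g' * Num.sqrt l * nr (b w)).
  rewrite /l (sqrtrV (ltW n0)).
  rewrite -{2}(sqr_sqrtr (ltW n0)); field; rewrite gt_eqF// sqrtr_gt0//.
by rewrite ler_pM2l.
Qed.

End Gap.
End RelativeGap.

(** * Approximate spectral decomposition *)

Section RootsOfUnity.

Lemma prim_root_exists (C : numClosedFieldType) n : (n > 0)%N ->
  exists z : C, n.-primitive_root z.
Proof.
pose p : {poly C} := 'X^n - 1; have [r Dp] := closed_field_poly_normal p.
move=> n_gt0; rewrite (monicP _) ?monicXnsubC // scale1r in Dp.
have rn1 : all n.-unity_root r by apply/allP => z; rewrite -root_prod_XsubC -Dp.
have sz_r : (n < (size r).+1)%N.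
  by rewrite -(size_prod_XsubC r id) -Dp size_XnsubC.
have [|z] := hasP (has_prim_root n_gt0 rn1 _ sz_r); last by exists z.
by rewrite -separable_prod_XsubC -Dp separable_Xn_sub_1 // pnatr_eq0 -lt0n.
Qed.

Lemma sum_root_powers (F : fieldType) (c : F) n : c ^+ n = 1 -> c != 1 ->
  \sum_(i < n) c ^+ i = 0.
Proof.
move=> cn c1; apply/eqP; have := subrX1 c n; rewrite cn subrr => /esym/eqP.
by rewrite mulf_eq0 subr_eq0 (negbTE c1).
Qed.

End RootsOfUnity.

Section Cayley.
Context {R : realType} {V : completeNormedModType R[i]}.
Variable dot : {dot V for Num.conj}.
Hypothesis dotV : induces_norm dot.
Local Notation nr := (dot_norm dot).
Local Notation rdot := (re_dot dot).
Local Notation blin := (blin dot).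
Local Notation adj := (adj dot).
Implicit Types (x y z : V) (w : R[i]) (f h : V -> V).

Lemma bounded_below_onto f g (c : R) : blin f -> adj f g -> 0 < c ->
  (forall x, c * nr x <= nr (f x)) -> inj0 g -> forall v, exists u, f u = v.
Proof.
move=> fb fg c0 fc g0.
have fl := blin_lin fb; have [L L0 fL] := blin_pos fb.
apply: (@closed_range_onto _ _ dot dotV (fun u v => f u = v) c^-1).
- by move=> k u v u' v' <- <-; rewrite fl.
- exact: lin0.
- move=> u v h; apply/eqP; rewrite -subr_eq0; apply/eqP.
  apply: (@small_eq0 _ _ dot _ (L + 1)) => e e0.
  have [u' [v' [<- hu hv]]] := h e e0.
  have -> : f u - v = f (u - u') - (v - f u') by rewrite (linB fl) opprB addrA subrK.
  apply: (le_trans (nrB_le _ _ _)); rewrite mulrDl mul1r lerD//.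
  by apply: (le_trans (fL _)); rewrite ler_pM2l.
- by move=> u v <-; rewrite mulrC ler_pdivlMr// mulrC.
- move=> y hy; apply: g0; apply: (@dot_inj _ _ dot) => z.
  by rewrite dotC -fg (hy z _ erefl) rmorph0 dot0l.
Qed.

Lemma conj_i : Num.conj 'i = - 'i :> R[i].
Proof. by rewrite /Num.conj/=; apply/eqP; rewrite eq_complex/= oppr0 !eqxx. Qed.

Lemma rdot_i f x : adj f f -> rdot x ('i *: f x) = 0.
Proof.
move=> fs; have : dot (f x) x = Num.conj (dot (f x) x) by rewrite -dotC -fs.
rewrite /re_dot dotZr conj_i -fs; case: (dot (f x) x) => u v /=.
rewrite /Num.conj/= => -[vE]; have -> : v = 0 by lra.
by rewrite oppr0 mulr0 mul0r subr0.
Qed.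

Lemma mdl_i : mdl 'i = 1 :> R.
Proof. by rewrite /mdl normc_def/= expr0n expr1n add0r sqrtr1. Qed.

(** The Cayley transform U = (1 - i f) / (1 + i f) is unitary. A point w of the
    unit circle corresponds to the real number n = - i (1 - w) / (1 + w); near
    w = -1, where n blows up, U - w is bounded below because f is bounded, and
    n = 0 is good enough. *)
Lemma cayley f : blin f -> adj f f -> exists2 U : V -> V,
  [/\ blin U, forall x y, dot (U x) (U y) = dot x y &
      forall h, linear h -> (forall x, f (h x) = h (f x)) -> forall x, U (h x) = h (U x)] &
  exists2 K : R, 0 < K & forall w, mdl w = 1 -> exists n : R, forall z,
      nr (f z - n%:C *: z) <= K * nr (U z - w *: z).
Proof.
move=> fb fs; have fl := blin_lin fb; have [L L0 fL] := blin_pos fb.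
pose T x := x + 'i *: f x; pose T' x := x - 'i *: f x.
have Tb : blin T by apply: blin_add; [exact: blin_id|exact: blin_scale].
have T'b : blin T' by apply: blin_sub; [exact: blin_id|exact: blin_scale].
have TT' : adj T T'.
  move=> x y; rewrite /T /T' dotDl dotBr dotZl dotZr conj_i fs; ring.
have comm x : T (T' x) = T' (T x).
  by rewrite /T /T' (linB fl) (linD fl) (linZ fl); apply: (@dot_inj _ _ dot) => u;
    rewrite !(dotDl, dotNl, dotZl); ring.
have iso x y : dot (T' x) (T' y) = dot (T x) (T y).
  by rewrite (adjC TT') comm TT'.
have nT x : nr x <= nr (T x).
  rewrite ler_nr /T !rdotDl !rdotDr [rdot ('i *: f x) x]rdotC rdot_i// !addr0 add0r.
  by rewrite lerDl rdot_ge0.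
have nT' x : nr (T' x) = nr (T x) by rewrite /dot_norm /re_dot iso.
have T'0 : inj0 T'.
  move=> x T'x; apply: (@nr_eq0 _ _ dot); apply/eqP; rewrite eq_le nr_ge0 andbT.
  by rewrite (le_trans (nT x))// -nT' T'x nr0.
have T0 : inj0 T.
  by move=> x Tx; apply: T'0; apply: (@nr_eq0 _ _ dot); rewrite nT' Tx nr0.
have [v|J TJ] := @choice V V (fun z y => T y = z).
  by apply: (bounded_below_onto Tb TT' ltr01 _ T'0) => x; rewrite mul1r.
have JT x : J (T x) = x.
  by apply/eqP; rewrite -subr_eq0; apply/eqP/T0; rewrite (linB (blin_lin Tb)) TJ subrr.
have Jb : blin J.
  split; last by exists 1 => x; rewrite mul1r -{2}(TJ x) nT.
  by move=> c x y; rewrite -{1}(TJ x) -{1}(TJ y) -(blin_lin Tb) JT.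
have TLe y : nr (T y) <= (1 + L) * nr y.
  apply: (le_trans (nrD _ _ _)); rewrite nrZ mdl_i mul1r mulrDl mul1r lerD2l.
  exact: fL.
exists (T' \o J).
  split; first exact: (blin_comp T'b Jb).
    by move=> x y /=; rewrite iso !TJ.
  move=> h hl hf x /=; have Th y : T (h y) = h (T y).
    by rewrite /T (linD hl) (linZ hl) hf.
  have -> : J (h x) = h (J x) by rewrite -{1}(TJ x) -Th JT.
  by rewrite /T' (linB hl) (linZ hl) hf.
have L1 : 0 < 1 + L by rewrite addr_gt0.
exists ((1 + L) ^+ 2) => [|w w1]; first by rewrite exprn_gt0.
have [wk|wk] := ltP (mdl (1 + w)) (1 + L)^-1.
  (* Here U - w dominates the identity, hence also f. *)
  exists 0 => z; rewrite scale0r subr0 /=; set y := J z.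
  have zE : z = T y by rewrite TJ.
  have -> : T' y - w *: z = 2%:C *: y - (1 + w) *: T y.
    rewrite zE /T' /T; apply: (@dot_inj _ _ dot) => u.
    by rewrite !(dotDl, dotNl, dotZl) (rmorph_nat (real_complex R) 2); ring.
  apply: (le_trans (fL _)); rewrite zE.
  have h1 : mdl (1 + w) * nr (T y) <= nr y.
    apply: (@le_trans _ _ ((1 + L)^-1 * ((1 + L) * nr y))).
      by apply: ler_pM => //; exact: ltW.
    by rewrite mulrA mulVf ?mul1r// gt_eqF.
  have h2 : nr y <= nr (2%:C *: y - (1 + w) *: T y).
    by apply: le_trans (nrB_ge _ _ _); rewrite !nrZ mdlR ger0_norm//; lra.
  apply: (@le_trans _ _ ((1 + L) * ((1 + L) * nr y))).
    by apply: ler_pM => //; [exact: ltW|lra].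
  by rewrite mulrA -expr2 ler_pM2l// exprn_gt0.
have w10 : 1 + w != 0.
  apply: contraTneq wk => ->; rewrite -ltNge /mdl normr0/= invr_gt0//.
have wn0 : w != 0.
  by apply: contra_eq_neq w1 => ->; rewrite /mdl normr0/= eq_sym oner_neq0.
have m0 : 0 < mdl (1 + w) by apply: lt_le_trans wk; rewrite invr_gt0.
pose n := - 'i * (1 - w) / (1 + w).
have [r nE] : exists r : R, n = r%:C.
  apply/complex_realP; rewrite CrealE; apply/eqP.
  have cw : Num.conj w = w^-1.
    by apply: (mulfI wn0); rewrite -mdl2 w1 expr1n mulfV.
  have w1' : 1 + w^-1 != 0.
    have -> : 1 + w^-1 = (1 + w) / w by field.
    by rewrite mulf_neq0 ?invr_eq0.
  have cM (c d : R[i]) : Num.conj (c * d) = Num.conj c * Num.conj d by exact: rmorphM.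
  have cV (c : R[i]) : Num.conj (c^-1) = (Num.conj c)^-1 by exact: fmorphV.
  have cN (c : R[i]) : Num.conj (- c) = - Num.conj c by exact: rmorphN.
  have c1D (c : R[i]) : Num.conj (1 + c) = 1 + Num.conj c by rewrite rmorphD rmorph1.
  rewrite /n !(cM, cV, c1D, cN) cw conj_i opprK; field.
  by rewrite wn0 w10.
exists r => z /=; set y := J z.
have zE : z = T y by rewrite TJ.
have -> : T' y - w *: z = ('i * (1 + w)) *: (r%:C *: y - f y).
  rewrite zE -nE /n /T' /T; apply: (@dot_inj _ _ dot) => u.
  have i2 : 'i * 'i = -1 :> R[i] by rewrite -expr2 sqr_i.
  rewrite !(dotDl, dotNl, dotZl) mulrBr 2!mulrA.
  have -> : 'i * (1 + w) * (- 'i * (1 - w)) / (1 + w) = 1 - w.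
    by transitivity (- ('i * 'i) * (1 - w)); [by field|rewrite i2 opprK mul1r].
  ring.
have -> : f z - r%:C *: z = - T (r%:C *: y - f y).
  rewrite zE /T (linB fl) (linD fl) !(linZ fl); apply: (@dot_inj _ _ dot) => u.
  by rewrite !(dotDl, dotNl, dotZl); ring.
rewrite nrN nrZ mdlM mdl_i mul1r; apply: (le_trans (TLe _)).
rewrite mulrA; apply: ler_wpM2r => //.
by rewrite expr2 -mulrA ler_peMr ?(ltW L1)// mulrC -ler_pdivrMr// mul1r.
Qed.

(** With U the Cayley transform, w_i the k-th roots of unity and
      phi_i = k^-1 sum_(j < k) w_i^-j U^j,
    the orthogonality of characters gives sum phi_i* phi_i = 1, as in the
    discrete Fourier transform, and (U - w_i) phi_i telescopes to
    k^-1 w_i (w_i^-k U^k - 1), of norm at most 2 / k. The point of this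
    construction is that even the sum over i of the squared norms of
    (f - n_i) phi_i tends to 0. *)
Lemma cayley_partition f : blin f -> adj f f -> exists2 K : R, 0 < K &
  forall k : nat, (0 < k)%N -> exists (n : 'I_k -> R) (phi phi' : 'I_k -> V -> V),
  [/\ forall i, blin (phi i) /\ adj (phi i) (phi' i),
      forall z, \sum_i phi' i (phi i z) = z,
      forall i z, nr (f (phi i z) - (n i)%:C *: phi i z) <= K / k%:R * nr z &
      forall i h, linear h -> (forall x, f (h x) = h (f x)) ->
        forall x, phi i (h x) = h (phi i x)].
Proof.
move=> fb fs; have [U [Ub Uiso Uh] [K K0 UK]] := cayley fb fs.
have Ul := blin_lin Ub.
have nU x : nr (U x) = nr x by rewrite /dot_norm /re_dot Uiso.
have nUk j x : nr (iter j U x) = nr x by elim: j => //= j; rewrite nU.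
exists (K * 2) => [|k k0]; first by rewrite mulr_gt0.
have [s sp] := @prim_root_exists R[i] k k0.
have sk : s ^+ k = 1 by exact: prim_expr_order.
have ms : mdl s = 1.
  have : mdl s ^+ k = 1.
    have mX j : mdl (s ^+ j) = mdl s ^+ j.
      by elim: j => [|j ih]; rewrite ?expr0 ?exprS ?mdlM ?ih// /mdl normr1.
    by rewrite -mX sk /mdl normr1.
  by move/eqP; rewrite pexpr_eq1// => /eqP.
have mX j : mdl (s ^+ j) = 1.
  by elim: j => [|j ih]; rewrite ?expr0 ?exprS ?mdlM ?ih ?ms ?mulr1// /mdl normr1.
have sn0 : s != 0.
  by apply: contra_eq_neq ms => ->; rewrite /mdl normr0/= eq_sym oner_neq0.
have cs : Num.conj s = s^-1.
  by apply: (mulfI sn0); rewrite -mdl2 ms expr1n mulfV.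
have cX j : Num.conj ((s^-1) ^+ j) = s ^+ j.
  have sj0 : s^-1 ^+ j != 0 by rewrite expf_neq0// invr_eq0.
  have m1 : mdl s^-1 = 1 by rewrite -cs /mdl norm_conjC.
  apply: (mulfI sj0); rewrite -mdl2.
  have -> : mdl (s^-1 ^+ j) = 1.
    by elim: j {sj0} => [|j ih]; rewrite ?expr0 ?exprS ?mdlM ?ih ?m1 ?mulr1// /mdl normr1.
  by rewrite expr1n exprVn mulVf// expf_neq0.
have kn0 : k%:R != 0 :> R[i] by rewrite pnatr_eq0 -lt0n.
pose phi (i : 'I_k) z := (k%:R^-1 : R[i]) *: \sum_(j < k) (s^-1) ^+ (i * j) *: iter j U z.
have phib i : blin (phi i).
  apply: blin_scale; apply: blin_sum => j _; apply: blin_scale; exact: blin_iter.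
have [i|phi' hphi'] := @choice 'I_k (V -> V) (fun i g => adj (phi i) g).
  by have [g _ hg] := blin_adj dotV (phib i); exists g.
have [i|n hn] := @choice 'I_k R (fun i n => forall z,
    nr (f z - n%:C *: z) <= K * nr (U z - s ^+ i *: z)); first exact: UK.
exists n, phi, phi'; split=> //.
- move=> z; apply: (@dot_inj _ _ dot) => y.
  rewrite dot_suml.
  under eq_bigr => i _ do rewrite (adjC (hphi' i)).
  have isok j x x' : dot (iter j U x) (iter j U x') = dot x x'.
    by elim: j => //= j; rewrite Uiso.
  transitivity (\sum_(j < k) \sum_(l < k) ((k%:R^-1 * k%:R^-1) *
      (dot (iter j U z) (iter l U y) * \sum_(i < k) (s ^+ l / s ^+ j) ^+ i))).
    under eq_bigr => i _.
      rewrite /phi dotZl dotZr fmorphV rmorph_nat mulrA dot_suml mulr_sumr.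
      under eq_bigr => j _.
        rewrite dot_sumr mulr_sumr.
        under eq_bigr => l _.
          rewrite dotZl dotZr cX.
          over.
        over.
      over.
    rewrite exchange_big/=; apply: eq_bigr => j _.
    rewrite exchange_big/=; apply: eq_bigr => l _.
    rewrite !mulr_sumr; apply: eq_bigr => i _.
    rewrite expr_div_n -!exprM exprVn ![(_ * i)%N]mulnC; ring.
  transitivity (\sum_(j < k) k%:R^-1 * dot z y); last first.
    rewrite sumr_const card_ord. by rewrite -[LHS]mulr_natl mulrA mulfV// mul1r.
  apply: eq_bigr => j _; rewrite (bigD1 j)//= [X in _ + X]big1 => [|l lj].
    rewrite mulfV ?expf_neq0// isok; under eq_bigr do rewrite expr1n.
    by rewrite sumr_const card_ord addr0; field.
  rewrite sum_root_powers ?mulr0//.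
    by rewrite expr_div_n -!exprM ![(_ * k)%N]mulnC !exprM sk !expr1n divr1.
  apply: contra_neq lj => h; apply/val_inj => /=; apply/eqP.
  have : s ^+ l == s ^+ j by rewrite -[X in X == _](divfK (expf_neq0 j sn0)) h mul1r.
  by rewrite (eq_prim_root_expr sp) !modn_small.
- move=> i z; apply: (le_trans (hn _ _)).
  rewrite -!mulrA ler_pM2l//.
  pose c := s^-1 ^+ i.
  have sc : s ^+ i * c = 1 by rewrite /c exprVn mulfV// expf_neq0.
  have -> : U (phi i z) - s ^+ i *: phi i z =
      (k%:R^-1 * s ^+ i) *: (c ^+ k *: iter k U z - z).
    rewrite /phi (linZ Ul) (lin_sum _ _ _ Ul) scalerA [s ^+ i * _]mulrC -!scalerA -scalerBr.
    congr (_ *: _).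
    have := telescope_sumr (fun j => c ^+ j *: iter j U z) (leq0n k).
    rewrite /= expr0 scale1r => <-.
    rewrite big_mkord scaler_sumr -sumrB scaler_sumr; apply: eq_bigr => j _ /=.
    by rewrite (linZ Ul) !scalerA scalerBr !scalerA !exprM -/c exprS mulrA sc mul1r.
  rewrite nrZ mdlM mX mulr1.
  have -> : mdl (k%:R^-1 : R[i]) = k%:R^-1.
    by rewrite -[k%:R](rmorph_nat (real_complex R)) -fmorphV mdlR ger0_norm// invr_ge0.
  rewrite [leRHS]mulrCA; apply: ler_wpM2l; first by rewrite invr_ge0.
  apply: (le_trans (nrB_le _ _ _)); rewrite nrZ nUk.
  have -> : mdl (c ^+ k) = 1.
    by rewrite /c -exprM mulnC exprM exprVn sk invr1 expr1n /mdl normr1.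
  lra.
- move=> i h hl fh x; rewrite /phi (linZ hl) (lin_sum _ _ _ hl).
  congr (_ *: _); apply: eq_bigr => j _; rewrite (linZ hl); congr (_ *: _).
  by elim: (nat_of_ord j) => //= l ->; rewrite Uh.
Qed.

End Cayley.

(** * The Sylvester equation in the Hilbert-Schmidt class *)

Section SylvesterHilbertSchmidt.
Context {R : realType} {V : completeNormedModType R[i]}.
Variable dot : {dot V for Num.conj}.
Hypothesis dotV : induces_norm dot.
Local Notation nr := (dot_norm dot).
Local Notation rdot := (re_dot dot).
Local Notation blin := (blin dot).
Local Notation adj := (adj dot).
Local Notation oproj := (oproj dot).
Local Notation inv_spec := (inv_spec dot).
Local Notation posop := (posop dot).
Local Notation hs2 := (hs_square dot).
Implicit Types (x y z w : V).

Lemma oproj_le p x : oproj p -> nr (p x) <= nr x.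
Proof. by move=> [_ ps pp]; exact: projection_le. Qed.

Lemma oprojC p : oproj p -> oproj (fun x => x - p x).
Proof.
move=> [pb ps pp]; split; first by apply: blin_sub => //; exact: blin_id.
  by move=> x y; rewrite dotBl dotBr ps.
by move=> x; rewrite (linB (blin_lin pb)) pp subrr subr0.
Qed.

Lemma small_square (M e : R) : 0 <= M -> 0 < e -> exists2 r : R, 0 < r & r ^+ 2 * M <= e.
Proof.
move=> M0 e0; have M1 : 0 < M + 1 by lra.
pose r := Num.min 1 (e / (M + 1)).
have r0 : 0 < r by rewrite lt_min ltr01 divr_gt0.
exists r => //; have r1 : r <= 1 by rewrite ge_min lexx.
have rM : r * (M + 1) <= e by rewrite -ler_pdivlMr// ge_min lexx orbT.
have : r ^+ 2 * M <= r * M.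
  by apply: ler_wpM2r => //; rewrite expr2 ler_piMl// ltW.
lra.
Qed.

Lemma small_inv_nat (M e : R) : 0 <= M -> 0 < e ->
  exists2 k, (0 < k)%N & M / k%:R <= e.
Proof.
move=> M0 e0; have h := archi_boundP (divr_ge0 M0 (ltW e0)).
exists (Num.bound (M / e)).+1 => //.
rewrite ler_pdivrMr// mulrC -ler_pdivrMr//; apply: (le_trans (ltW h)).
by rewrite ler_nat.
Qed.

(** The operator (b^2 - n) p + (1 - p) is selfadjoint and bounded below, hence
    invertible, and r is its inverse followed by p. *)
Lemma reduced_resolvent b p (D c n : R) : posop b -> oproj p ->
  (forall x, b (p x) = p (b x)) -> bounded_by dot D b -> 0 <= D -> 0 < c -> 0 < n ->
  (forall w, p w = w -> c * nr (b w) <= nr (sq b w - n%:C *: w)) ->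
  exists r : V -> V,
  [/\ blin r /\ adj r r, forall x, p (r x) = r x,
      forall x, sq b (r x) - n%:C *: r x = p x,
      forall x, nr (b (r x)) <= c^-1 * nr x &
      forall x, nr (r x) <= (D / c + 1) / n * nr x].
Proof.
move=> hb hp bp bD D0 c0 n0 hn; have [pb ps pp] := hp; have pl := blin_lin pb.
have bl := blin_lin (sq_blin hb).
have sqp x : sq b (p x) = p (sq b x) by rewrite /sq !bp.
pose C := (D / c + 1) / n.
have C0 : 0 < C by rewrite divr_gt0// ltr_wpDl// divr_ge0// ltW.
have hC w : p w = w -> nr w <= C * nr (sq b w - n%:C *: w).
  move=> pw; rewrite /C mulrAC ler_pdivlMr//.
  have h1 := hn w pw; have h2 := bD (b w).
  have h3 : n * nr w <= nr (sq b w) + nr (sq b w - n%:C *: w).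
    rewrite -{1}(gtr0_norm n0) -nrZR.
    have {1}-> : n%:C *: w = sq b w - (sq b w - n%:C *: w) by rewrite opprB addrC subrK.
    exact: nrB_le.
  have h4 : D * nr (b w) <= D / c * nr (sq b w - n%:C *: w).
    by rewrite -mulrA; apply: ler_wpM2l => //; rewrite mulrC ler_pdivlMr// mulrC.
  by rewrite mulrC; apply: (le_trans h3); rewrite mulrDl mul1r lerD2r; apply: le_trans h4.
pose f x := sq b (p x) - n%:C *: p x + (x - p x).
have fb : blin f.
  apply: blin_add; last by apply: blin_sub => //; exact: blin_id.
  by apply: blin_sub; [exact: (blin_comp (sq_blin hb) pb)|exact: blin_scale].
have fs : adj f f.
  move=> x y; rewrite /f !(dotDl, dotDr, dotNl, dotNr, dotZl, dotZr) conjR.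
  by rewrite (sq_adj hb) !ps sqp.
have pf x : p (f x) = sq b (p x) - n%:C *: p x.
  by rewrite /f (linD pl) !(linB pl) (linZ pl) !pp subrr addr0 -sqp pp.
have fbb x : (C + 1)^-1 * nr x <= nr (f x).
  rewrite mulrC ler_pdivrMr ?addr_gt0// mulrC mulrDl mul1r.
  rewrite -{1}(subrK (p x) x) addrC; apply: (le_trans (nrD _ _ _)); apply: lerD.
    apply: (le_trans (hC _ (pp x))); rewrite ler_pM2l// -pf.
    exact: oproj_le.
  have -> : x - p x = f x - p (f x) by rewrite pf /f addrAC subrr add0r.
  exact: (oproj_le (f x) (oprojC hp)).
have f0 : inj0 f.
  move=> x fx; apply: (@nr_eq0 _ _ dot); apply/eqP; rewrite eq_le nr_ge0 andbT.
  by have := fbb x; rewrite fx nr0 pmulr_rle0// invr_gt0 addr_gt0.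
have [v|r0 fr0] := @choice V V (fun v u => f u = v).
  by apply: (bounded_below_onto dotV fb fs _ fbb f0); rewrite invr_gt0 addr_gt0.
pose r x := p (r0 x).
have rE x : sq b (r x) - n%:C *: r x = p x by rewrite /r -pf fr0.
have pr x : p (r x) = r x by rewrite /r pp.
have rC x : nr (r x) <= C * nr x.
  apply: (le_trans (hC _ (pr x))); rewrite rE ler_pM2l//; exact: oproj_le.
have rs : adj r r.
  move=> x y; rewrite -(pr x) ps -(rE y) -[in RHS](pr y) -ps -(rE x).
  by rewrite !(dotBl, dotBr, dotZl, dotZr) conjR (sq_adj hb).
exists r; split=> //; first by split=> //; split; [exact: adj_linear rs|exists C].
move=> x; rewrite mulrC ler_pdivlMr// mulrC; apply: (le_trans (hn _ (pr x))).
by rewrite rE; exact: oproj_le.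
Qed.

Lemma weighted_sqrD (e s t : R) : 0 < e ->
  (s + t) ^+ 2 <= (1 + e) * s ^+ 2 + (1 + e^-1) * t ^+ 2.
Proof.
move=> e0; have e0' : 0 < e^-1 by rewrite invr_gt0.
have : 0 <= e^-1 * (e * s - t) ^+ 2 by rewrite mulr_ge0 ?sqr_ge0 ?ltW.
have -> : e^-1 * (e * s - t) ^+ 2 = e * s ^+ 2 - 2 * (s * t) + e^-1 * t ^+ 2.
  by field; rewrite gt_eqF.
rewrite sqrrD; lra.
Qed.

Section Partition.
Variables (k : nat) (phi phi' : 'I_k -> V -> V).
Hypothesis phib : forall i, blin (phi i) /\ adj (phi i) (phi' i).
Hypothesis phi1 : forall z, \sum_i phi' i (phi i z) = z.

Lemma partition_norm z : \sum_i nr (phi i z) ^+ 2 = nr z ^+ 2.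
Proof.
rewrite nr2 -[X in _ = rdot X _]phi1 rdot_suml; apply: eq_bigr => i _.
by rewrite (adj_rdot (adjC (phib i).2)) nr2.
Qed.

(** The adjoint of the isometry z |-> (phi_i z)_i is a contraction. *)
Lemma partition_synthesis (w : 'I_k -> V) :
  nr (\sum_i phi' i (w i)) ^+ 2 <= \sum_i nr (w i) ^+ 2.
Proof.
set z := \sum_i _; have := partition_norm z.
have h : nr z ^+ 2 = \sum_i rdot (w i) (phi i z).
  rewrite nr2 {1}/z rdot_suml; apply: eq_bigr => i _.
  by rewrite (adj_rdot (adjC (phib i).2)).
have h2 : 2 * nr z ^+ 2 <= \sum_i nr (w i) ^+ 2 + \sum_i nr (phi i z) ^+ 2.
  rewrite h mulr_sumr -big_split/=; apply: ler_sum => i _.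
  have := rdot_ge0 dot (w i - phi i z); rewrite !rdotE (rdotC _ (phi i z) (w i)) !nr2.
  lra.
move=> h3; rewrite h3 in h2; lra.
Qed.

End Partition.

Section Sylvester.
Variables (a b p q X T T' : V -> V) (g : R).
Hypotheses (ha : posop a) (hb : posop b) (hp : oproj p) (hq : oproj q).
Hypotheses (aq : forall x, a (q x) = q (a x)) (bp : forall x, b (p x) = p (b x)).
Hypothesis g0 : 0 < g.
Hypothesis gapP : forall l m, inv_spec (sq a) q l -> inv_spec (sq b) p m ->
  g * Num.sqrt (l * m) <= `|l - m|.
Hypotheses (Xb : blin X) (qX : forall x, q (X x) = X x) (Xp : forall x, X (p x) = X x).
Hypothesis TT' : adj T T'.
Hypothesis XT : forall x, X (sq b x) - sq a (X x) = a (T (b x)).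

(** Y is the sum of phi_i* w_i over the good i, where n_i satisfies the first
    alternative of the dichotomy and w_i = a phi_i T b r_i with r_i the reduced
    resolvent of b^2 at n_i. The Hilbert-Schmidt bound comes from
    |b r_i| <= 1 / (g' sqrt n_i) and from |a phi_i z|^2 being close to
    n_i |phi_i z|^2. For the error, the equation gives
      phi_i X - w_i = (a^2 - n_i) phi_i X r_i
    when i is good; when n_i is far from the spectrum, phi_i X is small by the
    second alternative; and when |n_i| < t, phi_i a^2 y is small, which is enough
    because X x can be approximated by a^2 y. *)
Lemma sylvester_approx (g' t : R) : 0 < g' -> g' < g -> 0 < t ->
  exists A K : R, forall (k : nat) (s : R), (0 < k)%N -> 0 < s -> exists2 Y : V -> V,
    (hs2 Y <= ((1 + s + K / (s * t ^+ 2 * k%:R)) / g' ^+ 2)%:E * hs2 T)%E &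
    forall x y, nr (X x - Y x) ^+ 2 <= A / k%:R * nr x ^+ 2 +
      2 * nr (X x - sq a y) ^+ 2 + (4 * t ^+ 2 + K / k%:R) * nr y ^+ 2.
Proof.
move=> g'0 g'g t0.
have [ab as_ _ _] := ha; have [bb bs _ _] := hb; have [qb qs qq] := hq.
have al := blin_lin ab; have Xl := blin_lin Xb.
have [K K0 part] := cayley_partition dotV (sq_blin ha) (sq_adj ha).
have [d d0 dich] := gap_dichotomy ha hb hp hq aq bp g0 gapP g'0 g'g t0.
have [D D0 bD] := blin_pos bb; have [CX CX0 XC] := blin_pos Xb.
pose CR := (D / (g' * Num.sqrt t) + 1) / t.
have st0 : 0 < Num.sqrt t by rewrite sqrtr_gt0.
have CR0 : 0 < CR by rewrite divr_gt0// ltr_wpDl// divr_ge0 ?mulr_ge0// ltW.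
pose A0 := K * CX * (CR + d^-1).
have d'0 : 0 < d^-1 by rewrite invr_gt0.
have KX0 : 0 < K * CX by rewrite mulr_gt0.
have A00 : 0 < A0 by rewrite mulr_gt0// addr_gt0.
exists (A0 ^+ 2), (4 * K ^+ 2) => k s k0 s0.
have [n [phi [phi' [phib phi1 phin phih]]]] := part k k0.
have k0' : 0 < k%:R :> R by rewrite ltr0n.
have k1' : 1 <= k%:R :> R by rewrite ler1n.
have phil i := blin_lin (phib i).1.
have phia i x : phi i (a x) = a (phi i x) by apply: phih.
have phiq i x : phi i (q x) = q (phi i x).
  by apply: phih => [|z]; [exact: (blin_lin qb)|rewrite /sq !aq].
pose good i := [/\ t <= n i, 0 < n i & forall w, p w = w ->
  g' * Num.sqrt (n i) * nr (b w) <= nr (sq b w - (n i)%:C *: w)].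
have [i|r hr] := @choice 'I_k (V -> V) (fun i r => good i ->
  [/\ blin r /\ adj r r, forall x, p (r x) = r x,
      forall x, sq b (r x) - (n i)%:C *: r x = p x,
      forall x, nr (b (r x)) <= (g' * Num.sqrt (n i))^-1 * nr x &
      forall x, nr (r x) <= CR * nr x]).
  have [[tn n0 hn]|ng] := pselect (good i); last by exists id.
  have sn0 : 0 < Num.sqrt (n i) by rewrite sqrtr_gt0.
  have c0 : 0 < g' * Num.sqrt (n i) by rewrite mulr_gt0.
  have [r [h1 h2 h3 h4 h5]] := reduced_resolvent hb hp bp bD (ltW D0) c0 n0 hn.
  exists r => _; split=> // x; apply: (le_trans (h5 x)); apply: ler_wpM2r => //.
  rewrite /CR; apply: ler_pM.
  - by rewrite ltW// ltr_wpDl// divr_ge0// ltW.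
  - by rewrite invr_ge0 ltW.
  - rewrite lerD2r ler_pM2l// lef_pV2 ?posrE ?mulr_gt0// ler_pM2l//.
    exact: ler_wsqrtr.
  - by rewrite lef_pV2 ?posrE.
pose w i x := if `[<good i>] then a (phi i (T (b (r i x)))) else 0.
pose Y x := \sum_i phi' i (w i x).
exists Y.
  have wE i : good i -> w i = (a \o phi i \o T) \o (b \o r i).
    by move=> gi; apply/funext => x; rewrite /w; case: asboolP.
  have adj0 : adj (fun=> 0) (fun=> 0) by move=> x y; rewrite dot0l dot0r.
  apply: (@le_trans _ _ (\sum_i hs2 (w i))%E).
    rewrite /hs_square -esum_sum; last by move=> *; rewrite lee_fin sqr_ge0.
    apply: le_esum => e _; rewrite sumEFin lee_fin.
    exact: (partition_synthesis phib phi1).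
  have hsw i : (hs2 (w i) <= \esum_(e in onb dot)
      (if `[<good i>] then (g' ^+ 2 * n i)^-1 * nr (a (phi i (T e))) ^+ 2 else 0)%:E)%E.
    case: asboolP => gi; last first.
      rewrite [leRHS]esum1//; apply: le_trans (lexx 0%E); rewrite /hs_square esum1// => e _.
      by rewrite /w; case: asboolP => // _; rewrite nr0 expr0n.
    have [[rb rs] _ _ br _] := hr i gi; have [_ n0 _] := gi.
    have n2 : ((g' * Num.sqrt (n i))^-1) ^+ 2 = (g' ^+ 2 * n i)^-1.
      by rewrite exprVn exprMn sqr_sqrtr ?ltW.
    have gn : 0 <= (g' ^+ 2 * n i)^-1 by rewrite invr_ge0 mulr_ge0 ?sqr_ge0 ?ltW.
    rewrite (wE i gi).
    have aT : adj (a \o phi i \o T) (T' \o (phi' i \o a)).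
      exact: (adj_comp (adj_comp as_ (phib i).2) TT').
    have := hs2_mulr dotV (_ : 0 <= (g' * Num.sqrt (n i))^-1) aT (adj_comp bs rs) br.
    rewrite n2 invr_ge0 mulr_ge0 ?sqrtr_ge0 ?(ltW g'0)// => /(_ isT) /le_trans; apply.
    by rewrite /hs_square esumZ// => e; rewrite sqr_ge0.
  apply: (le_trans (lee_sum _ (fun i _ => hsw i))).
  rewrite -esum_sum; last first.
    move=> e i _ _; rewrite lee_fin; case: asboolP => // -[_ n0 _].
    by rewrite mulr_ge0 ?sqr_ge0// invr_ge0 mulr_ge0 ?sqr_ge0 ?ltW.
  set th := (1 + s + _).
  have g'2 : 0 < g' ^+ 2 by rewrite exprn_gt0.
  have th0 : 0 <= th.
    apply: addr_ge0; first by lra.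
    have K4 : 0 <= 4 * K ^+ 2 by have := sqr_ge0 K; lra.
    have st : 0 < s * t ^+ 2 * k%:R by apply: mulr_gt0 => //; apply: mulr_gt0 => //; exact: exprn_gt0.
    by rewrite divr_ge0// ltW.
  rewrite /hs_square -esumZ; last by move=> e; exact: sqr_ge0.
    apply: le_esum => e _; rewrite sumEFin lee_fin; set z := T e.
    pose B := K / (t * k%:R) * nr z.
    have B2 : B ^+ 2 / s * k%:R = K ^+ 2 / (s * t ^+ 2 * k%:R) * nr z ^+ 2.
      by rewrite /B; field; rewrite !gt_eqF.
    have B0 : 0 <= B by rewrite mulr_ge0// divr_ge0 ?mulr_ge0// ltW.
    apply: (@le_trans _ _ (\sum_(i < k) g' ^- 2 * ((1 + s) * nr (phi i z) ^+ 2 + B ^+ 2 / s))).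
      apply: ler_sum => i _; case: asboolP => [[tn n0 _]|_]; last first.
        rewrite mulr_ge0 ?invr_ge0 ?(ltW g'2)// addr_ge0//.
          by rewrite mulr_ge0 ?sqr_ge0//; lra.
        by rewrite divr_ge0 ?sqr_ge0// ltW.
      rewrite invfM -mulrA ler_pM2l ?invr_gt0//.
      rewrite mulrC ler_pdivrMr// -sq_rdot//.
      have -> : sq a (phi i z) = (n i)%:C *: phi i z + (sq a (phi i z) - (n i)%:C *: phi i z).
        by rewrite addrC subrK.
      rewrite rdotDl rdotZl -nr2.
      have h1 : rdot (sq a (phi i z) - (n i)%:C *: phi i z) (phi i z) <=
          n i * (B * nr (phi i z)).
        apply: (le_trans (rdot_CS _ _ _)); rewrite mulrA; apply: ler_wpM2r => //.
        apply: (le_trans (phin i z)); rewrite /B mulrA; apply: ler_wpM2r => //.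
        have -> : n i * (K / (t * k%:R)) = K / k%:R * (n i / t).
          by field; rewrite !gt_eqF.
        apply: ler_peMr.
          by rewrite divr_ge0// ltW.
        by rewrite ler_pdivlMr ?mul1r.
      have h2 : B * nr (phi i z) <= s * nr (phi i z) ^+ 2 + B ^+ 2 / s.
        have : 0 <= s^-1 * ((B - s * nr (phi i z)) ^+ 2 + B * (s * nr (phi i z))).
          apply: mulr_ge0; first by rewrite invr_ge0 ltW.
          apply: addr_ge0; first exact: sqr_ge0.
          by apply: mulr_ge0 => //; apply: mulr_ge0 => //; exact: ltW.
        have -> : s^-1 * ((B - s * nr (phi i z)) ^+ 2 + B * (s * nr (phi i z))) =
          B ^+ 2 / s - B * nr (phi i z) + s * nr (phi i z) ^+ 2.
          by field; rewrite gt_eqF.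
        lra.
      have h3 := ler_wpM2l (ltW n0) h2.
      by rewrite [leRHS]mulrC mulrDr mulrDl mul1r mulrDr -addrA -[in leRHS]mulrDr; lra.
    rewrite -mulr_sumr big_split/= -mulr_sumr (partition_norm phib phi1).
    rewrite sumr_const card_ord -mulr_natr B2.
    have -> : th / g' ^+ 2 * nr z ^+ 2 = g' ^- 2 * (th * nr z ^+ 2) by rewrite mulrC mulrA mulrC; ring.
    rewrite ler_pM2l ?invr_gt0// /th [leRHS]mulrDl lerD2l; apply: ler_wpM2r; first exact: sqr_ge0.
    apply: ler_wpM2r; first by rewrite invr_ge0 !mulr_ge0 ?sqr_ge0 ?ltW.
    by have := sqr_ge0 K; lra.
  by rewrite divr_ge0 ?sqr_ge0.
move=> x y.
pose e i := phi i (X x) - w i x.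
have -> : X x - Y x = \sum_i phi' i (e i).
  rewrite -{1}(phi1 (X x)) -sumrB; apply: eq_bigr => i _.
  by rewrite (linB (blin_lin (adj_blin (phib i).2 (phib i).1))).
apply: (le_trans (partition_synthesis phib phi1 _)).
pose z := X x - sq a y.
have eb i : nr (e i) ^+ 2 <= (A0 / k%:R * nr x) ^+ 2 + 2 * nr (phi i z) ^+ 2 +
    (4 * t ^+ 2 * nr (phi i y) ^+ 2 + 4 * (K / k%:R * nr y) ^+ 2).
  have pos1 : 0 <= 2 * nr (phi i z) ^+ 2 by apply: mulr_ge0 => //; exact: sqr_ge0.
  have pos2 : 0 <= 4 * t ^+ 2 * nr (phi i y) ^+ 2 by rewrite !mulr_ge0// ltW.
  have pos3 : 0 <= 4 * (K / k%:R * nr y) ^+ 2 by apply: mulr_ge0 => //; exact: sqr_ge0.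
  have pos4 : 0 <= (A0 / k%:R * nr x) ^+ 2 by exact: sqr_ge0.
  have first_case (C : R) : 0 <= C -> C <= CR + d^-1 ->
      nr (e i) <= K / k%:R * (CX * (C * nr x)) ->
      nr (e i) ^+ 2 <= (A0 / k%:R * nr x) ^+ 2.
    move=> C0 hC he.
    have Ak : 0 <= A0 / k%:R * nr x by apply: mulr_ge0 => //; apply: divr_ge0; exact: ltW.
    rewrite ler_sqr ?nnegrE//.
    apply: (le_trans he); rewrite /A0.
    have -> : K / k%:R * (CX * (C * nr x)) = C * (K * CX / k%:R * nr x) by ring.
    have -> : K * CX * (CR + d^-1) / k%:R * nr x = (CR + d^-1) * (K * CX / k%:R * nr x) by ring.
    apply: ler_wpM2r => //; apply: mulr_ge0 => //; apply: divr_ge0; exact: ltW.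
  have [gi|ngi] := pselect (good i).
    have [_ pr rE br rC] := hr i gi.
    have eE : e i = sq a (phi i (X (r i x))) - (n i)%:C *: phi i (X (r i x)).
      rewrite /e /w; case: asboolP => // _; rewrite -phia -XT -{1}(Xp x) -rE.
      rewrite (linB Xl) (linZ Xl) !(linB (phil i)) (linZ (phil i)) /sq !phia.
      by apply: (@rdot_inj _ _ dot) => u; rewrite !rdotE; ring.
    have := first_case CR (ltW CR0) (_ : CR <= CR + d^-1); rewrite lerDl (ltW d'0) => /(_ isT) h.
    have : nr (e i) ^+ 2 <= (A0 / k%:R * nr x) ^+ 2.
      apply: h; rewrite eE; apply: (le_trans (phin i _)); apply: ler_wpM2l.
        by rewrite divr_ge0// ltW.
      by apply: (le_trans (XC _)); rewrite ler_pM2l.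
    lra.
  have eE : e i = phi i (X x) by rewrite /e /w; case: asboolP => // _; rewrite subr0.
  have [tn|nt] := leP t `|n i|.
    have [[n0 gn]|bad] := dich (n i) tn.
      by case: ngi; split=> //; rewrite gtr0_norm in tn.
    have := first_case d^-1 (ltW d'0) (_ : d^-1 <= CR + d^-1); rewrite lerDr (ltW CR0) => /(_ isT) h.
    have : nr (e i) ^+ 2 <= (A0 / k%:R * nr x) ^+ 2.
      apply: h; rewrite eE; have qz : q (phi i (X x)) = phi i (X x) by rewrite -phiq qX.
      have := le_trans (bad _ qz) (phin i _); rewrite mulrC -ler_pdivlMr// => /le_trans; apply.
      have -> : K / k%:R * (CX * (d^-1 * nr x)) = K / k%:R * (CX * nr x) / d by ring.
      rewrite ler_pM2r//; apply: ler_wpM2l; first by rewrite divr_ge0// ltW.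
      exact: XC.
    lra.
  have yE : X x = z + sq a y by rewrite /z subrK.
  have h1 : nr (phi i (sq a y)) <= t * nr (phi i y) + K / k%:R * nr y.
    rewrite {1}/sq !phia; have := phin i y.
    have := nrB_ge dot (sq a (phi i y)) ((n i)%:C *: phi i y); rewrite nrZR.
    have : `|n i| * nr (phi i y) <= t * nr (phi i y) by apply: ler_wpM2r => //; exact: ltW.
    rewrite /sq; lra.
  have h2 : nr (phi i (sq a y)) ^+ 2 <= 2 * (t ^+ 2 * nr (phi i y) ^+ 2) + 2 * (K / k%:R * nr y) ^+ 2.
    apply: (@le_trans _ _ ((t * nr (phi i y) + K / k%:R * nr y) ^+ 2)).
      by rewrite ler_sqr ?nnegrE// (le_trans _ h1).
    have := weighted_sqrD (t * nr (phi i y)) (K / k%:R * nr y) (ltr01 : 0 < 1 :> R).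
    by rewrite invr1 exprMn; lra.
  have h3 : nr (e i) ^+ 2 <= 2 * nr (phi i z) ^+ 2 + 2 * nr (phi i (sq a y)) ^+ 2.
    rewrite eE yE (linD (phil i)).
    apply: (@le_trans _ _ ((nr (phi i z) + nr (phi i (sq a y))) ^+ 2)).
      by rewrite ler_sqr ?nnegrE ?addr_ge0// nrD.
    have := weighted_sqrD (nr (phi i z)) (nr (phi i (sq a y))) (ltr01 : 0 < 1 :> R).
    by rewrite invr1; lra.
  lra.
apply: (le_trans (ler_sum _ (fun i _ => eb i))).
rewrite !big_split/= -!mulr_sumr !(partition_norm phib phi1) !sumr_const !card_ord.
rewrite -/z le_eqVlt; apply/orP; left; apply/eqP.
by field; rewrite gt_eqF.
Qed.


Lemma sq_dense x (e : R) : 0 < e -> exists y, nr (x - sq a y) <= e.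
Proof.
move=> e0.
have [||w [y _ <-] h] := @dense_subspace _ _ dot dotV [set sq a y | y in setT] _ _ x e e0.
- have al := blin_lin (sq_blin ha); split; first by exists 0 => //; rewrite (lin0 al).
  by move=> c _ _ [u _ <-] [v _ <-]; exists (c *: u + v) => //; rewrite al.
- move=> y hy; apply: (sq_inj0 ha); apply: (@dot_inj _ _ dot) => z.
  by rewrite dotC -(sq_adj ha) hy ?rmorph0 ?dot0l//; exists z.
by exists y.
Qed.

(** On a finite orthonormal family X is the limit of the approximations, so it
    satisfies their Hilbert-Schmidt bound in the limit. The parameters are chosen
    in this order: e' for the approximation of X x by a^2 y, then t, and k last,
    because the constant A depends on t. *)
Lemma sylvester_hs2 (tT : R) : hs2 T = tT%:E -> (hs2 X <= (tT / g ^+ 2)%:E)%E.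
Proof.
move=> hT; have tT0 : 0 <= tT by have := hs2_ge0 dot T; rewrite hT lee_fin.
apply: esum_le_seq => s us sE.
pose c := tT / g ^+ 2; have c0 : 0 <= c by rewrite divr_ge0// sqr_ge0.
suff key e : 0 < e -> e <= 1 -> \sum_(x <- s) nr (X x) ^+ 2 <= c + e * (23 * c + 6).
  apply/ler_addgt0Pl => e e0; have c1 : 0 < 23 * c + 6 by lra.
  apply: (le_trans (key (Num.min 1 (e / (23 * c + 6))) _ _)).
  - by rewrite lt_min ltr01 divr_gt0.
  - by rewrite ge_min lexx.
  by rewrite addrC lerD2r -ler_pdivlMr// ge_min lexx orbT.
move=> e0 e1.
have [e' e'0 he'] := small_square (ler0n R (2 * size s)) (exprn_gt0 2 e0).
have [x|y hy] := @choice V V (fun x y => nr (X x - sq a y) <= e'); first exact: sq_dense.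
pose S1 := \sum_(x <- s) nr x ^+ 2; pose S2 := \sum_(x <- s) nr (y x) ^+ 2.
have S10 : 0 <= S1 by apply: sumr_ge0 => x _; exact: sqr_ge0.
have S20 : 0 <= S2 by apply: sumr_ge0 => x _; exact: sqr_ge0.
have [t t0 ht] := small_square (mulr_ge0 (ler0n R 4) S20) (exprn_gt0 2 e0).
have g'0 : 0 < g / (1 + e) by rewrite divr_gt0//; lra.
have [|A [K hY]] := @sylvester_approx (g / (1 + e)) t g'0 _ t0.
  by rewrite ltr_pdivrMr ?ltr_pMr//; lra.
pose M := `|A| * S1 + `|K| * S2 + `|K| / (e * t ^+ 2).
have et0 : 0 < e * t ^+ 2 by rewrite mulr_gt0// exprn_gt0.
have M1 : 0 <= `|A| * S1 by rewrite mulr_ge0.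
have M2 : 0 <= `|K| * S2 by rewrite mulr_ge0.
have M3 : 0 <= `|K| / (e * t ^+ 2) by rewrite divr_ge0// ltW.
have M0 : 0 <= M by rewrite !addr_ge0.
have [k k0 hk] := small_inv_nat M0 (exprn_gt0 2 e0).
have k0' : 0 < k%:R :> R by rewrite ltr0n.
have [Y Yhs YX] := hY k e k0 e0.
have hK : K / (e * t ^+ 2 * k%:R) <= e.
  apply: (@le_trans _ _ (e ^+ 2)); last by rewrite expr2 ger_pMr.
  apply: le_trans hk; rewrite invfM mulrA; apply: ler_wpM2r; first by rewrite invr_ge0 ltW.
  apply: (@le_trans _ _ (`|K| / (e * t ^+ 2))); last by rewrite lerDr addr_ge0.
  by apply: ler_wpM2r; [rewrite invr_ge0 ltW|exact: ler_norm].
have sY : \sum_(x <- s) nr (Y x) ^+ 2 <= (1 + 2 * e) * (1 + e) ^+ 2 * c.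
  rewrite -lee_fin; apply: (@le_trans _ _ (hs2 Y)); first exact: esum_ge_seq.
  apply: (le_trans Yhs); rewrite hT -EFinM lee_fin.
  have -> : (1 + 2 * e) * (1 + e) ^+ 2 * c = (1 + 2 * e) / (g / (1 + e)) ^+ 2 * tT.
    rewrite /c; field; do ?[apply/andP; split]; by rewrite gt_eqF//; lra.
  apply: ler_wpM2r => //; apply: ler_wpM2r; first by rewrite invr_ge0 sqr_ge0.
  lra.
have sXY : \sum_(x <- s) nr (X x - Y x) ^+ 2 <= 3 * e ^+ 2.
  apply: (@le_trans _ _ (\sum_(x <- s) (A / k%:R * nr x ^+ 2 + 2 * e' ^+ 2 +
      (4 * t ^+ 2 + K / k%:R) * nr (y x) ^+ 2))).
    apply: ler_sum => x _; apply: (le_trans (YX x (y x))).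
    rewrite lerD2r lerD2l ler_pM2l// ler_sqr ?nnegrE ?(ltW e'0)//.
  rewrite !big_split/= -!mulr_sumr -/S1 -/S2 big_const_seq count_predT iter_addr_0.
  have h1 : A / k%:R * S1 + K / k%:R * S2 <= e ^+ 2.
    apply: le_trans hk; rewrite [_ * S1]mulrAC [_ * S2]mulrAC -mulrDl.
    apply: ler_wpM2r; first by rewrite invr_ge0 ltW.
    have := ler_wpM2r S10 (ler_norm A); have := ler_wpM2r S20 (ler_norm K).
    rewrite /M; lra.
  have h2 : (2 * e' ^+ 2) *+ size s <= e ^+ 2.
    by apply: le_trans he'; rewrite -mulr_natr natrM le_eqVlt; apply/orP; left; apply/eqP; ring.
  rewrite mulrDl; move: ht; lra.
apply: (@le_trans _ _ (\sum_(x <- s) ((1 + e) * nr (Y x) ^+ 2 + (1 + e^-1) * nr (X x - Y x) ^+ 2))).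
  apply: ler_sum => x _; apply: le_trans (weighted_sqrD _ _ e0).
  rewrite ler_sqr ?nnegrE ?addr_ge0// -{1}(subrK (Y x) (X x)) addrC.
  exact: nrD.
rewrite big_split/= -!mulr_sumr.
have h1 : (1 + e) * \sum_(x <- s) nr (Y x) ^+ 2 <= (1 + e) * ((1 + 2 * e) * (1 + e) ^+ 2 * c).
  by apply: ler_wpM2l => //; lra.
have h2 : (1 + e^-1) * \sum_(x <- s) nr (X x - Y x) ^+ 2 <= 3 * e ^+ 2 + 3 * e.
  have -> : 3 * e ^+ 2 + 3 * e = (1 + e^-1) * (3 * e ^+ 2) by field; rewrite gt_eqF.
  by apply: ler_wpM2l => //; rewrite addr_ge0// invr_ge0 ltW.
have e2 : e ^+ 2 <= e by rewrite expr2 ger_pMr.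
have e3 : e ^+ 3 <= e ^+ 2 by rewrite exprS ger_pMl// exprn_gt0.
have e4 : e ^+ 4 <= e ^+ 3 by rewrite exprS ger_pMl// exprn_gt0.
have h3 : (1 + e) * ((1 + 2 * e) * (1 + e) ^+ 2 * c) <= (1 + 23 * e) * c.
  have -> : (1 + e) * ((1 + 2 * e) * (1 + e) ^+ 2 * c) =
    (1 + 5 * e + 9 * e ^+ 2 + 7 * e ^+ 3 + 2 * e ^+ 4) * c by ring.
  by apply: ler_wpM2r => //; lra.
move: h3; rewrite mulrDl mul1r; lra.
Qed.

End Sylvester.
End SylvesterHilbertSchmidt.

(** * Unbounded operators as graphs *)

Section Graphs.
Context {R : realType} {V : completeNormedModType R[i]}.
Variable dot : {dot V for Num.conj}.
Hypothesis dotV : induces_norm dot.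
Local Notation nr := (dot_norm dot).
Local Notation rdot := (re_dot dot).
Local Notation blin := (blin dot).
Local Notation adj := (adj dot).
Local Notation oproj := (oproj dot).
Local Notation inv_spec := (inv_spec dot).
Local Notation posop := (posop dot).
Local Notation hs2 := (hs_square dot).
Implicit Types (x y z w u v : V) (f g a b q : V -> V) (A : operator V).

Lemma graph_comp f g : (graph f * graph g)%OP = graph (f \o g).
Proof.
apply/seteqP; split=> -[u v]; rewrite /graph /op_comp/=; last by move=> ->; exists (g u).
by move=> [w [-> ->]].
Qed.

Lemma graph_sub f g : (graph f - graph g)%OP = graph (fun x => f x - g x).
Proof.
apply/seteqP; split=> -[u v]; rewrite /graph /op_sub/=; last by move=> ->; exists (f u), (g u).
by move=> [x [y [-> -> ->]]].
Qed.

Lemma op_apply_graph f x : op_apply (graph f) x = f x.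
Proof.
by have : graph f (x, op_apply (graph f) x) by apply: (@xgetPex _ 0 [set v | graph f (x, v)]); exists (f x).
Qed.

Lemma adjoint_graph f g : adj f g -> adjoint dot (graph f) = graph g.
Proof.
move=> fg; apply/seteqP; split=> -[u v]; rewrite /graph /adjoint/=; last first.
  by move=> -> [x y] /= ->; rewrite fg.
move=> h; apply: (@dot_inj _ _ dot) => z.
by rewrite dotC -(h (z, f z) erefl)/= fg -dotC.
Qed.

Lemma hs_norm_graph f g : adj f g -> hs_norm dot (graph f) = (hs2 f `^ 2^-1)%E.
Proof.
move=> fg; rewrite /hs_norm (adjoint_graph fg) graph_comp; congr (_ `^ _)%E.
apply: eq_esum => e _; rewrite op_apply_graph/= (adjC fg).
by rewrite nr2.
Qed.

Lemma hs_norm_sqr f g : adj f g -> (hs_norm dot (graph f) ^+ 2 = hs2 f)%E.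
Proof.
move=> fg; rewrite (hs_norm_graph fg); have := hs2_ge0 dot f.
case: (hs2 f) => [r| |//] r0; last by rewrite poweRyr ?invr_eq0 ?pnatr_eq0.
by rewrite poweR_EFin -EFin_expe powR12_sqrt// sqr_sqrtr.
Qed.

Lemma hs_norm_lty f g : adj f g -> (hs_norm dot (graph f) < +oo)%E = (hs2 f < +oo)%E.
Proof.
move=> fg; rewrite (hs_norm_graph fg); apply/idP/idP; last exact: poweR_lty.
move=> h; rewrite ltey; apply: contraTneq h => ->.
by rewrite poweRyr ?invr_eq0 ?pnatr_eq0// ltxx.
Qed.

Lemma bounded_operator_graph f : blin f -> bounded_operator (graph f).
Proof.
move=> fb; have fl := blin_lin fb; have [C C0 fC] := blin_pos fb.
pose F : {linear V -> V} := HB.pack f (GRing.isLinear.Build R[i] V V *:%R f fl).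
exists F; split=> // x; apply/cvgrPdist_le => e e0.
have [er eE] : exists r : R, e = r%:C by apply/complex_realP/gtr0_real.
move: e0; rewrite eE ltcR => r0.
apply/nbhs_ballP; exists (er / C)%:C; first by rewrite /= ltcR divr_gt0.
move=> y; rewrite -ball_normE/= !(normE dotV) ltcR lecR => h.
have -> : f x - f y = f (x - y) by rewrite (linB fl).
by apply: (le_trans (fC _)); rewrite mulrC -ler_pdivlMr// ltW.
Qed.

Lemma hilbert_schmidt_graph f g : blin f -> adj f g -> (hs2 f < +oo)%E ->
  hilbert_schmidt dot (graph f).
Proof.
by move=> fb fg h; split; [exact: bounded_operator_graph|rewrite (hs_norm_lty fg)].
Qed.

Lemma dense_near (D : set V) x : dense D -> near_set dot D x.
Proof.
move=> Dd e e0; have [||w [xw Dw]] := Dd (ball x e%:C).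
- by exists x; apply: ballxx; rewrite ltcR.
- by apply: ball_open; rewrite ltcR.
exists w => //; move: xw; rewrite -ball_normE/= (normE dotV) ltcR.
exact: ltW.
Qed.

(** A is the restriction of F to a dense subspace; the graph of F is closed
    because F is bounded. *)
Lemma op_closure_graph (F : V -> V) (A : operator V) : blin F ->
  (forall p, A p -> p.2 = F p.1) ->
  (forall x (e : R), 0 < e -> exists2 p, A p & nr (x - p.1) <= e) ->
  op_closure A = graph F.
Proof.
move=> Fb AF Ad; have Fl := blin_lin Fb; have [C C0 FC] := blin_pos Fb.
apply/seteqP; split=> -[u v]; rewrite /op_closure /graph/=.
  move=> h; apply/eqP; rewrite -subr_eq0; apply/eqP; apply: (@small_eq0 _ _ dot _ (1 + C)) => e e0.
  have [|q [Aq [/= uq vq]]] := h (ball (u, v) e%:C).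
    by apply: nbhsx_ballx; rewrite ltcR.
  move: uq vq; rewrite -!ball_normE/= !(normE dotV) !ltcR => uq vq.
  have -> : v - F u = (v - q.2) - F (u - q.1).
    by rewrite (linB Fl) (AF _ Aq) opprB addrA subrK.
  apply: (le_trans (nrB_le _ _ _)); rewrite mulrDl mul1r lerD ?(ltW vq)//.
  by apply: (le_trans (FC _)); rewrite ler_pM2l// ltW.
move=> -> B /nbhs_ballP[e /= e0 eB].
have [er eE] : exists r : R, e = r%:C by apply/complex_realP/gtr0_real.
move: e0; rewrite eE ltcR => r0.
have C1 : 0 < 1 + C by rewrite addr_gt0.
have [|q Aq uq] := Ad u (er / 2 / (1 + C)); first by rewrite !divr_gt0.
exists q; split=> //; apply: eB; split; rewrite /= -ball_normE/= (normE dotV) eE ltcR.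
  apply: (le_lt_trans uq); rewrite ltr_pdivrMr// mulrDr mulr1.
  by have := mulr_gt0 r0 C0; lra.
rewrite (AF _ Aq) -(linB Fl); apply: (le_lt_trans (FC _)).
have : (1 + C) * nr (u - q.1) <= er / 2 by rewrite mulrC -ler_pdivlMr.
by have := nr_ge0 dot (u - q.1); rewrite mulrDl mul1r; lra.
Qed.

(** A bounded inverse of A - l on the range of q would bound |u| by |(A - l) u|
    for u = a^2 z with z in the range of q. *)
Lemma inv_spec_spectrum a q A l : oproj q ->
  (forall u v, A (u, v) <-> u = sq a v) ->
  (forall x, a (q x) = q (a x)) -> inv_spec (sq a) q l ->
  real_spectrum (op_ran (graph q)) (graph q * A * graph q)%OP l.
Proof.
move=> [_ _ qq] AE aq hl [_ [c hc]]; apply: hl; exists (mdl c) => z qz.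
have qu : q (sq a z) = sq a z by rewrite /sq -!aq qz.
have /hc : op_restrict (op_ran (graph q))
    (graph q * A * graph q - graph (fun u => l%:C *: u))%OP (sq a z, z - l%:C *: sq a z).
  split; last by exists (sq a z); rewrite /graph/= qu.
  exists z, (l%:C *: sq a z); split=> //.
  exists (sq a z); split; first by rewrite /graph/= qu.
  by exists z; split; [exact/AE|rewrite /graph/= qz].
rewrite !(normE dotV) lecE => /andP[_ /=].
rewrite [X in _ <= complex.Re X]mulrC ReZ mulrC => /le_trans; apply.
by apply: ler_wpM2r => //; exact: Re_le_mdl.
Qed.

Lemma near_perp (D : set V) z : (forall x, near_set dot D x) ->
  (forall w, D w -> dot w z = 0) -> z = 0.
Proof.
move=> hD hz; apply: (@small_eq0 _ _ dot _ 1) => e e0; rewrite mul1r.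
have [->|z0] := eqVneq z 0; first by rewrite nr0 ltW.
have [w Dw zw] := hD z e e0.
rewrite -(ler_pM2r (nr_gt0 dot z0)) -expr2 nr2.
have -> : rdot z z = rdot (z - w) z by rewrite rdotDl rdotNl {3}/re_dot hz// subr0.
by apply: (le_trans (rdot_CS _ _ _)); apply: ler_wpM2r.
Qed.

(** Coercivity of the form makes B bounded below. Being selfadjoint, B is closed,
    and a vector orthogonal to its range is in its kernel, hence null; so B is
    onto with the bounded inverse a = A^(-1/2). *)
Lemma form_inverse_sqrt (dom : set V) h A B : positive_definite_form dot dom h ->
  form_operator dot dom h A B -> exists a,
  [/\ posop a, forall u v, B (u, v) <-> u = a v,
      forall u v, A (u, v) <-> u = sq a v,
      forall u, dom u <-> exists x, u = a x &
      forall x, quad h (a x) = nr x ^+ 2].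
Proof.
move=> [[domsub domd] _ _ _ [c c0 hc]] [_ [[Bd Bs] Bnn BBA] Bdom hB].
have domnear x : near_set dot (op_dom B) x by rewrite Bdom; exact: dense_near.
have BP u v : B (u, v) <-> forall s t, B (s, t) -> dot t u = dot s v.
  rewrite -{1}Bs; split=> [h0 s t Bst|h0 [s t] Bst]; last exact: h0.
  exact: (h0 (s, t)).
have Blin k u v u' v' : B (u, v) -> B (u', v') -> B (k *: u + u', k *: v + v').
  move=> /BP h1 /BP h2; apply/BP => s t Bp.
  by rewrite !(dotDr, dotZr) (h1 _ _ Bp) (h2 _ _ Bp).
have B0 : B (0, 0) by apply/BP => s t _; rewrite !dot0r.
have Bfun u v v' : B (u, v) -> B (u, v') -> v = v'.
  move=> /BP h1 /BP h2; apply/eqP; rewrite -subr_eq0; apply/eqP.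
  apply: (near_perp domnear) => w [w' Bw].
  by rewrite dotBr -(h1 _ _ Bw) -(h2 _ _ Bw) subrr.
have Bapp u v : B (u, v) -> op_apply B u = v.
  move=> Buv; apply: (Bfun u _ _ _ Buv).
  by apply: (@xgetPex _ 0 [set v | B (u, v)]); exists v.
have Bquad u v : B (u, v) -> dom u /\ quad h u = nr v ^+ 2.
  move=> Buv; have du : dom u by rewrite -Bdom; exists v.
  by split=> //; rewrite /quad hB// (Bapp _ _ Buv) nr2.
have sc : 0 < Num.sqrt c by rewrite sqrtr_gt0.
pose C := (Num.sqrt c)^-1; have C0 : 0 < C by rewrite invr_gt0.
have Bb u v : B (u, v) -> nr u <= C * nr v.
  move=> /Bquad[du hu]; rewrite mulrC ler_pdivlMr//.
  rewrite -(ler_pXn2r (_ : 0 < 2)%N) ?nnegrE ?mulr_ge0 ?(ltW sc)//.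
  by rewrite exprMn (sqr_sqrtr (ltW c0)) mulrC -hu nr2; exact: hc.
have [v|a Ba] := @choice V V (fun v u => B (u, v)).
  apply: (closed_range_onto dotV (A := fun u v => B (u, v)) (C := C)) => //.
    move=> u v' happ; apply/BP => s t Bst; apply/eqP; rewrite -subr_eq0 -normr_eq0 -mdlE.
    apply/eqP; congr (_%:C); apply/eqP; rewrite eq_le mdl_ge0 andbT.
    apply: (@small_le0 _ _ (nr t + nr s)) => e e0.
    have [u' [w [Bu uu vw]]] := happ e e0.
    have -> : dot t u - dot s v' = dot t (u - u') - dot s (v' - w).
      by rewrite !dotBr ((BP u' w).1 Bu _ _ Bst) opprB addrA subrK.
    have h1 : mdl (dot t (u - u')) <= nr t * e.
      by apply: (le_trans (mdl_dot _ _ _)); apply: ler_wpM2l.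
    have h2 : mdl (dot s (v' - w)) <= nr s * e.
      by apply: (le_trans (mdl_dot _ _ _)); apply: ler_wpM2l.
    rewrite -lecR mdlE; apply: (le_trans (ler_normB _ _)).
    by rewrite -!mdlE -rmorphD/= lecR mulrDl lerD.
  move=> y hy; have : B (y, 0).
    by apply/BP => s t Bst; rewrite (hy _ _ Bst) dot0r.
  move=> /Bb; rewrite nr0 mulr0 => y0.
  by apply: (@nr_eq0 _ _ dot); apply/eqP; rewrite eq_le y0 nr_ge0.
have Bu u v : B (u, v) -> u = a v.
  move=> Buv; apply/eqP; rewrite -subr_eq0; apply/eqP.
  have := Bb _ _ (Blin (-1) _ _ _ _ (Ba v) Buv).
  rewrite !scaleN1r addNr nr0 mulr0 addrC => y0.
  by apply: (@nr_eq0 _ _ dot); apply/eqP; rewrite eq_le y0 nr_ge0.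
have aa : adj a a.
  by move=> x y; have := (BP (a y) y).1 (Ba y) _ _ (Ba x).
exists a; split.
- split=> //; first by split; [exact: adj_linear aa|exists C => x; exact: Bb].
    move=> x; rewrite rdotC; have h0 : 0 <= dot x (a x) := Bnn _ _ (Ba x).
    by move: h0; rewrite lecE => /andP[_].
  by move=> x ax; have := Ba x; rewrite ax => /(Bfun 0 0 x B0).
- by move=> u v; split=> [|->]; [exact: Bu|exact: Ba].
- move=> u v; rewrite -BBA; split=> [[w [/= /Bu -> /Bu ->]]//|->].
  by exists (a v); split; exact: Ba.
- move=> u; rewrite -Bdom; split=> [[v /Bu ->]|[x ->]]; first by exists v.
  by exists x.
- by move=> x; case: (Bquad _ _ (Ba x)).
Qed.

End Graphs.

(** * Comparison of the two forms *)

Section FormPair.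
Context {R : realType} {V : completeNormedModType R[i]}.
Variable dot : {dot V for Num.conj}.
Hypothesis dotV : induces_norm dot.
Local Notation nr := (dot_norm dot).
Local Notation rdot := (re_dot dot).
Local Notation blin := (blin dot).
Local Notation adj := (adj dot).
Local Notation oproj := (oproj dot).
Local Notation inv_spec := (inv_spec dot).
Local Notation posop := (posop dot).
Local Notation hs2 := (hs_square dot).
Implicit Types (x y z w u v : V) (a b p q X T : V -> V).

Lemma orthogonal_projection_oproj (p : {linear V -> V}) :
  orthogonal_projection dot p -> oproj p.
Proof.
move=> [pp ps]; have pa : adj p p by [].
split=> //; split; first exact: adj_linear pa.
by exists 1 => x; rewrite mul1r; exact: projection_le.
Qed.

(** G is H^(1/2) M^(-1/2), the inequality being h[b x] <= C^2 m[b x]. *)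
Lemma bounded_transition a b (C : R) : posop a -> posop b ->
  (forall x, exists2 y, b x = a y & nr y <= C * nr x) ->
  exists2 G, blin G & forall x, a (G x) = b x.
Proof.
move=> [ab _ _ ai] [bb _ _ _] h.
have [x|G hG] := @choice V V (fun x y => b x = a y /\ nr y <= C * nr x).
  by have [y hy1 hy2] := h x; exists y.
exists G; last by move=> x; case: (hG x).
split; last by exists C => x; case: (hG x).
have al := blin_lin ab; have bl := blin_lin bb.
have aG x : a (G x) = b x by case: (hG x).
move=> c x y; apply/eqP; rewrite -subr_eq0; apply/eqP/ai.
by rewrite (linB al) (linD al) (linZ al) !aG bl subrr.
Qed.

(** With s^2 and t^2 the values of the two forms at a vector, the relative
    perturbation bound compares the two norms. *)
Lemma form_comparison (s t e : R) : 0 <= s -> 0 <= t -> 0 <= e ->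
  `|s ^+ 2 - t ^+ 2| <= e * Num.sqrt (s ^+ 2 * t ^+ 2) -> s <= (1 + e) * t.
Proof.
move=> s0 t0 e0; have -> : Num.sqrt (s ^+ 2 * t ^+ 2) = s * t.
  by rewrite -exprMn sqrtr_sqr ger0_norm ?mulr_ge0.
move=> h.
rewrite leNgt; apply/negP => ts.
have h1 : s ^+ 2 - t ^+ 2 <= e * (s * t) by apply: le_trans h; exact: ler_norm.
have ts' : t <= s by apply: le_trans (ltW ts); rewrite mulrDl mul1r lerDl mulr_ge0.
have sp : 0 < s by apply: le_lt_trans ts; rewrite mulr_ge0// addr_ge0.
have h2 : (1 + e) * t * s < s * s by rewrite ltr_pM2r.
have h3 : t * t <= t * s by rewrite ler_wpM2l.
move: h1; rewrite !expr2; lra.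
Qed.

(** G and G' are H^(1/2) M^(-1/2) and M^(1/2) H^(-1/2). The adjoint E of G' maps
    b x to a x, so it is the closure of H^(-1/2) M^(1/2), and s = G - E. *)
Lemma difference_operator (dom : set V) (sqrtH sqrtM : operator V) a b G G' :
  dense dom -> (forall u, dom u -> exists x, u = b x) ->
  posop a -> posop b ->
  (forall u v, sqrtH (u, v) <-> u = a v) -> (forall u v, sqrtM (u, v) <-> u = b v) ->
  blin G -> (forall x, a (G x) = b x) -> blin G' -> (forall x, b (G' x) = a x) ->
  exists s s', [/\ blin s, adj s s',
    (sqrtH * sqrtM^-1 - op_closure (sqrtH^-1 * sqrtM))%OP = graph s &
    forall x, a (s (b x)) = sq b x - sq a x].
Proof.
move=> domd domb ha hb HE ME Gb aG G'b bG'.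
have [ab as_ _ ai] := ha; have [bb bs _ bi] := hb.
have al := blin_lin ab.
have [E Eb G'E] := blin_adj dotV G'b; have EG' := adjC G'E.
have [Gs _ GGs] := blin_adj dotV Gb.
have EbE x : E (b x) = a x.
  by apply: (@dot_inj _ _ dot) => z; rewrite EG' bs bG' as_.
exists (fun x => G x - E x), (fun x => Gs x - G' x); split.
- exact: blin_sub.
- by move=> x y; rewrite dotBl dotBr GGs EG'.
- have -> : (sqrtH * sqrtM^-1)%OP = graph G.
    apply/seteqP; split=> -[u v]; rewrite /op_comp /op_inv /graph/=.
      move=> [w [/ME -> /HE]]; rewrite -aG => /eqP; rewrite -subr_eq0 -(linB al) => /eqP/ai/eqP.
      by rewrite subr_eq0 => /eqP ->.
    by move=> ->; exists (b u); split; [exact/ME|apply/HE; rewrite aG].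
  rewrite (@op_closure_graph _ _ _ dotV E) ?graph_sub//.
    by move=> [u v] [w []]; rewrite /op_inv/= => /ME -> /HE ->; rewrite EbE.
  move=> x e e0; have [w dw xw] := dense_near dotV x domd e0.
  have [y wE] := domb w dw; exists (b y, a y); last by rewrite -wE.
  by exists y; split=> /=; [exact/ME|exact/HE].
- by move=> x; rewrite (linB al) aG EbE.
Qed.

(** The value gp = +oo, which occurs when one of the spectra is empty, makes every
    g > 0 admissible and forces X = 0. *)
Lemma hs2_gap_bound a b p q X T T' (gp : \bar R) :
  posop a -> posop b -> oproj p -> oproj q ->
  (forall x, a (q x) = q (a x)) -> (forall x, b (p x) = p (b x)) ->
  blin X -> (forall x, q (X x) = X x) -> (forall x, X (p x) = X x) ->
  adj T T' -> (forall x, X (sq b x) - sq a (X x) = a (T (b x))) ->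
  (0 < gp)%E -> (forall l m, inv_spec (sq a) q l -> inv_spec (sq b) p m ->
    (gp <= (`|l - m| / Num.sqrt (l * m))%:E)%E) ->
  (hs2 T < +oo)%E -> (hs2 X < +oo)%E /\ (hs2 X <= hs2 T / gp ^+ 2)%E.
Proof.
move=> ha hb hp hq aq bp Xb qX Xp TT' XT gp0 hgap Tfin.
have [t tE] : exists t : R, hs2 T = t%:E.
  exists (fine (hs2 T)); rewrite fineK// ge0_fin_numE//; exact: hs2_ge0.
have key (g : R) : 0 < g -> (g%:E <= gp)%E -> (hs2 X <= (t / g ^+ 2)%:E)%E.
  move=> g0 ggp; apply: (sylvester_hs2 dotV ha hb hp hq aq bp g0 _ Xb qX Xp TT' XT tE).
  move=> l m hl hm; have := le_trans ggp (hgap l m hl hm); rewrite lee_fin => h.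
  have [s0|s0] := eqVneq (Num.sqrt (l * m)) 0; first by rewrite s0 mulr0.
  by rewrite -ler_pdivlMr// lt0r s0 sqrtr_ge0.
have t0 : 0 <= t by have := hs2_ge0 dot T; rewrite tE lee_fin.
rewrite tE; case: gp gp0 hgap key => [g|_ hgap key|//].
  rewrite lte_fin => g0 _ key; have := key g g0 (lexx _) => h; split.
    by apply: le_lt_trans h _; rewrite ltry.
  by rewrite -EFin_expe inver expf_eq0/= gt_eqF// -EFinM.
have h (g : R) : 0 < g -> (hs2 X <= (t / g ^+ 2)%:E)%E by move=> g0; apply: key => //; rewrite leey.
split; first by apply: le_lt_trans (h 1 ltr01) _; rewrite ltry.
have -> : ((+oo : \bar R) ^+ 2)%E = +oo%E by rewrite expe2 mulyy.
rewrite invey mule0; apply/lee_addgt0Pr => e e0; rewrite add0e.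
have [g g0 hg] := small_square t0 e0.
have := h g^-1; rewrite invr_gt0 => /(_ g0) /le_trans; apply.
by rewrite lee_fin exprVn invrK mulrC.
Qed.

(** p - q = (1 - q) p - q (1 - p), where the two terms have orthogonal ranges and
    the second one is the adjoint of (1 - p) q. *)
Lemma hs2_projections p q : oproj p -> oproj q ->
  hs2 (fun x => p x - q x) =
  (hs2 (fun x => (p x - q (p x))%R) + hs2 (fun x => (q x - p (q x))%R))%E.
Proof.
move=> [pb ps pp] [qb qs qq].
have -> : hs2 (fun x => q x - p (q x)) = hs2 (fun x => q (x - p x)).
  apply: (hs2_adj dotV) => x y.
  by rewrite dotBl ps !qs (linB (blin_lin qb)) dotBr.
rewrite /hs_square -esumD; try by move=> *; rewrite lee_fin sqr_ge0.
apply: eq_esum => e _; rewrite -EFinD; congr (_%:E).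
have -> : p e - q e = (p e - q (p e)) - q (e - p e).
  by rewrite (linB (blin_lin qb)) opprB addrA subrK.
have h : rdot (p e - q (p e)) (q (e - p e)) = 0.
  by rewrite -(adj_rdot qs) (linB (blin_lin qb)) qq subrr rdot0l.
move: (p e - q (p e)) (q (e - p e)) h => u v h.
by rewrite !nr2 !rdotE (rdotC _ v u) h; ring.
Qed.

End FormPair.

(** * The perturbation bound *)

Theorem theorem3p5 (R : realType) (V : completeNormedModType R[i])
    (dot : {dot V for Num.conj}) (dotV : induces_norm dot)
    (dom : set V) (h m : V -> V -> R[i])
    (h_pd : positive_definite_form dot dom h)
    (m_pd : positive_definite_form dot dom m)
    (bH bM sqrtH sqrtM : operator V)
    (bH_h : form_operator dot dom h bH sqrtH)
    (bM_m : form_operator dot dom m bM sqrtM)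
    (eta : R) (eta_ge0 : 0 <= eta)
    (h_m : forall phi psi, dom phi -> dom psi ->
       `|h phi psi - m phi psi| <=
         (eta * Num.sqrt (quad h phi * quad m psi))%:C)
    (projQ projP : {linear V -> V})
    (projQ_orth : orthogonal_projection dot projQ)
    (projP_orth : orthogonal_projection dot projP)
    (projQ_bH : commutes projQ bH) (projP_bM : commutes projP bM) :
  let S := (sqrtH * sqrtM^-1 - op_closure (sqrtH^-1 * sqrtM))%OP in
  let Q := graph projQ in let Qp := (1 - Q)%OP in
  let P := graph projP in let Pp := (1 - P)%OP in
  let A := (Qp * bH * Qp)%OP in let H := (Q * bH * Q)%OP in
  let M := (P * bM * P)%OP in let W := (Pp * bM * Pp)%OP in
  let gapAM := gap (real_spectrum (op_ran Qp) A)
                   (real_spectrum (op_ran P) M) in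
  let gapWH := gap (real_spectrum (op_ran Pp) W)
                   (real_spectrum (op_ran Q) H) in
  let hs := hs_norm dot in
  (hs (Qp * S * P)%OP < +oo)%E ->
  (hs (Pp * adjoint dot S * Q)%OP < +oo)%E ->
  (0 < gapAM)%E -> (0 < gapWH)%E ->
  [/\ hilbert_schmidt dot (Qp * P)%OP,
      hilbert_schmidt dot (Pp * Q)%OP &
      hilbert_schmidt dot (P - Q)%OP] /\
  [/\ (hs (Qp * P)%OP ^+ 2 <= hs (Qp * S * P)%OP ^+ 2 / gapAM ^+ 2)%E,
      (hs (Pp * Q)%OP ^+ 2 <= hs (Q * S * Pp)%OP ^+ 2 / gapWH ^+ 2)%E &
      (hs (P - Q)%OP ^+ 2 <= hs (Qp * S * P)%OP ^+ 2 / gapAM ^+ 2 +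
                             hs (Q * S * Pp)%OP ^+ 2 / gapWH ^+ 2)%E].
Proof.
(* a and b are the inverses of the square roots of the two operators. *)
have [a [ha HE bHE doma quada]] := form_inverse_sqrt dotV h_pd bH_h.
have [b [hb ME bME domb quadb]] := form_inverse_sqrt dotV m_pd bM_m.
have [ab as_ a0 ai] := ha; have [bb bs b0 bi] := hb.
have hq := orthogonal_projection_oproj projQ_orth.
have hp := orthogonal_projection_oproj projP_orth.
have [qb qs qq] := hq; have [pb ps pp] := hp.
have hqc := oprojC hq; have hpc := oprojC hp.
have aq x : a (projQ x) = projQ (a x).
  rewrite (commute_sqrt ab as_ a0 ai qb)// => y.
  by apply/(bHE _ _)/projQ_bH/bHE.
have bp x : b (projP x) = projP (b x).
  rewrite (commute_sqrt bb bs b0 bi pb)// => y.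
  by apply/(bME _ _)/projP_bM/bME.
have cmp u : dom u -> `|quad h u - quad m u| <= eta * Num.sqrt (quad h u * quad m u).
  move=> du; rewrite -lecR; apply: le_trans (h_m u u du du).
  by rewrite /quad -ReN -ReD normc_ge_Re.
have [G Gb aG] : exists2 G, blin dot G & forall x, a (G x) = b x.
  apply: (bounded_transition (C := 1 + eta) ha hb) => x.
  have db : dom (b x) by apply/domb; exists x.
  have [y ay] := (doma _).1 db; exists y => //.
  by apply: form_comparison => //; rewrite -(quada y) -(quadb x) -ay; exact: cmp.
have [G' G'b bG'] : exists2 G', blin dot G' & forall x, b (G' x) = a x.
  apply: (bounded_transition (C := 1 + eta) hb ha) => x.
  have da : dom (a x) by apply/doma; exists x.
  have [y ay] := (domb _).1 da; exists y => //.
  apply: form_comparison => //; rewrite -(quadb y) -(quada x) -ay distrC [X in Num.sqrt X]mulrC.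
  exact: cmp.
have [[_ domd] _ _ _ _] := h_pd.
have [s [s' [sb ss' SE asb]]] := difference_operator dotV domd
  (fun u => (domb u).1) ha hb HE ME Gb aG G'b bG'.
have [sl s'l] := (blin_lin sb, adj_linear (adjC ss')).
move=> S Q Qp P Pp A H M W gapAM gapWH hs.
pose qc x := x - projQ x; pose pc x := x - projP x.
have QpE : Qp = graph qc by rewrite /Qp /Q graph_sub.
have PpE : Pp = graph pc by rewrite /Pp /P graph_sub.
have [qcb qcs qcc] := hqc; have [pcb pcs pcc] := hpc.
have qcB x y : qc (x - y) = qc x - qc y by exact: (linB (blin_lin qcb)).
have pcB x y : pc (x - y) = pc x - pc y by exact: (linB (blin_lin pcb)).
have aqc x : a (qc x) = qc (a x) by rewrite (linB (blin_lin ab)) aq.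
have bpc x : b (pc x) = pc (b x) by rewrite (linB (blin_lin bb)) bp.
have aT1 : adj dot (qc \o s \o projP) (projP \o (s' \o qc)).
  exact: (adj_comp (adj_comp qcs ss') ps).
have aT2 : adj dot (pc \o s' \o projQ) (projQ \o (s \o pc)).
  exact: (adj_comp (adj_comp pcs (adjC ss')) qs).
have aX1 : adj dot (qc \o projP) (projP \o qc) by exact: (adj_comp qcs ps).
have aX2 : adj dot (pc \o projQ) (projQ \o pc) by exact: (adj_comp pcs qs).
have aD : adj dot (fun x => projP x - projQ x) (fun x => projP x - projQ x).
  by move=> x y; rewrite dotBl dotBr ps qs.
have T1E : (Qp * S * P)%OP = graph (qc \o s \o projP).
  by rewrite QpE /S SE !graph_comp.
have T2E : (Pp * adjoint dot S * Q)%OP = graph (pc \o s' \o projQ).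
  by rewrite PpE /S SE (adjoint_graph ss') !graph_comp.
have T2'E : (Q * S * Pp)%OP = graph (projQ \o s \o pc).
  by rewrite PpE /S SE !graph_comp.
have X1E : (Qp * P)%OP = graph (qc \o projP) by rewrite QpE graph_comp.
have X2E : (Pp * Q)%OP = graph (pc \o projQ) by rewrite PpE graph_comp.
have DE : (P - Q)%OP = graph (fun x => projP x - projQ x) by rewrite graph_sub.
have aT2' : adj dot (projQ \o s \o pc) (pc \o s' \o projQ) := adjC aT2.
rewrite /hs T1E T2E T2'E X1E X2E DE !(hs_norm_lty aT1, hs_norm_lty aT2).
rewrite (hs_norm_sqr aX1) (hs_norm_sqr aX2) (hs_norm_sqr aD) (hs_norm_sqr aT1) (hs_norm_sqr aT2').
move=> T1fin T2fin gAM gWH.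
have s'E x : b (s' (a x)) = sq b x - sq a x.
  apply: (@dot_inj _ _ dot) => y.
  by rewrite bs (adjC ss') as_ asb dotBr dotBl (sq_adj hb) (sq_adj ha).
have [X1fin X1le] : (hs_square dot (qc \o projP) < +oo)%E /\
    (hs_square dot (qc \o projP) <= hs_square dot (qc \o s \o projP) / gapAM ^+ 2)%E.
  apply: (hs2_gap_bound dotV ha hb hp hqc aqc bp (blin_comp qcb pb) _ _ aT1 _ gAM _ T1fin).
  - by move=> x /=; rewrite qcc.
  - by move=> x /=; rewrite pp.
  - move=> x /=; rewrite aqc -bp asb qcB /sq !bp.
    by rewrite -!aqc.
  - move=> l n hl hn; apply: ereal_inf_lbound; exists l.
      by rewrite /A QpE; exact: (inv_spec_spectrum dotV hqc bHE aqc hl).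
    by exists n => //; exact: (inv_spec_spectrum dotV hp bME bp hn).
(* For P_perp Q the two operators exchange their roles, and the right-hand side of
   the Sylvester equation is - P_perp S* Q. *)
have aT2n : adj dot (fun x => - (pc \o s' \o projQ) x) (fun x => - (projQ \o (s \o pc)) x).
  by move=> x y; rewrite dotNl dotNr aT2.
have T2b : blin dot (pc \o s' \o projQ).
  exact: (blin_comp (blin_comp pcb (adj_blin ss' sb)) qb).
have T2n : hs_square dot (fun x => - (pc \o s' \o projQ) x) = hs_square dot (pc \o s' \o projQ).
  by apply: hs2_eq_nr => x; rewrite nrN.
have [X2fin X2le] : (hs_square dot (pc \o projQ) < +oo)%E /\
    (hs_square dot (pc \o projQ) <= hs_square dot (projQ \o s \o pc) / gapWH ^+ 2)%E.
  rewrite (hs2_adj dotV aT2') -T2n.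
  apply: (hs2_gap_bound dotV hb ha hq hpc bpc aq (blin_comp pcb qb) _ _ aT2n _ gWH _ _).
  - by move=> x /=; rewrite pcc.
  - by move=> x /=; rewrite qq.
  - move=> x /=; rewrite (linN (blin_lin bb)) bpc -aq s'E pcB opprB /sq !aq.
    by rewrite -!bpc.
  - move=> l n hl hn; apply: ereal_inf_lbound; exists l.
      by rewrite /W PpE; exact: (inv_spec_spectrum dotV hpc bME bpc hl).
    by exists n => //; exact: (inv_spec_spectrum dotV hq bHE aq hn).
  - by rewrite T2n.
have Dsum : hs_square dot (fun x => projP x - projQ x) =
    (hs_square dot (qc \o projP) + hs_square dot (pc \o projQ))%E.
  exact: hs2_projections.
split; split.
- exact: hilbert_schmidt_graph (blin_comp qcb pb) aX1 X1fin.
- exact: hilbert_schmidt_graph (blin_comp pcb qb) aX2 X2fin.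
- apply: hilbert_schmidt_graph (blin_sub pb qb) aD _ => //.
  by rewrite Dsum lte_add_pinfty.
- exact: X1le.
- exact: X2le.
- by rewrite Dsum; apply: leeD.
Qed.
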